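(* Let $n\ge2$ and let $a=\sum_{\alpha\in I(\mathbb{KP}_n)}a_\alpha\chi_\alpha\in C(\mathbb{KP}_n)$ with $a_\alpha\in\mathbb C$. The random walk associated to $a$, i.e. the sequence $(\mathcal F(a)^{\star k})_{k\in\mathbb N}$, converges if and only if, for all $\alpha\in I(\mathbb{KP}_n)$, the complex number $\frac{a_\alpha}{d_\alpha}$ is an element of the open unit disc $\mathbb D$ or equals $1$.
   Context: Sekine quantum group $\mathbb{KP}_n$ ($n\ge2$). Put $\eta=e^{2\imath\pi/n}$; all indices are taken modulo $n$. $C(\mathbb{KP}_n)=\bigoplus_{i,j\in\mathbb Z_n}\mathbb C e_{(i,j)}\oplus M_n(\mathbb C)$ as a $*$-algebra, where the $e_{(i,j)}$ are the units of the one-dimensional summands and $E_{i,j}$ ($1\le i,j\le n$) are matrix units of $M_n(\mathbb C)$. The coproduct is $\Delta(e_{(i,j)})=\sum_{s,t\in\mathbb Z_n}e_{(s,t)}\otimes e_{(i-s,j-t)}+\frac1n\sum_{m,r=1}^n\eta^{i(m-r)}E_{m,r}\otimes E_{m+j,r+j}$, $\Delta(E_{i,j})=\sum_{s,t\in\mathbb Z_n}\eta^{s(i-j)}e_{(-s,-t)}\otimes E_{i-t,j-t}+\sum_{s,t\in\mathbb Z_n}\eta^{s(j-i)}E_{i-t,j-t}\otimes e_{(s,t)}$. The Haar state is $\int_{\mathbb{KP}_n}\big(\sum x_{(i,j)}e_{(i,j)}+\sum X_{i,j}E_{i,j}\big)=\frac1{2n^2}\big(\sum_{i,j}x_{(i,j)}+n\sum_iX_{i,i}\big)$.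 For $x\in C(\mathbb{KP}_n)$, $\mathcal F(x)$ is the linear functional $y\mapsto\int_{\mathbb{KP}_n}yx$. The convolution of functionals is $\phi\star\psi=(\phi\otimes\psi)\circ\Delta$, and $\phi^{\star k}$ is the $k$-fold convolution power. Convergence is in the finite-dimensional dual space of $C(\mathbb{KP}_n)$. Irreducible representations: $I(\mathbb{KP}_n)$ is the set of (classes of) irreducible representations, $d_\alpha$ is the dimension and $\chi_\alpha$ the character of $\alpha$. It consists of the one-dimensional $\rho_l^\pm=\sum_{i,j}\eta^{il}e_{(i,j)}\pm\sum_{m=1}^nE_{m,m+l}$ ($l\in\mathbb Z_n$; $\rho_0^+$ is the unit), the two-dimensional $\mathfrak X^{u,v}$ ($u\in\mathbb Z_n$, $1\le v\le\lfloor\frac{n-1}2\rfloor$) with characters $2\sum_{s,t\in\mathbb Z_n}\eta^{su}\cos(\frac{2tv\pi}n)e_{(s,t)}$, and, if $n$ is even, also the one-dimensional $\sigma_l^\pm=\sum_{i,j}(-1)^j\eta^{il}e_{(i,j)}\pm\sum_{m=1}^n(-1)^mE_{m,m+l}$ ($l\in\mathbb Z_n$). *)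

(* Defs.v *)
From HB Require Import structures.
From mathcomp Require Import all_boot all_order all_algebra.
From mathcomp Require Import all_classical all_reals all_analysis.
From mathcomp Require Import complex.

Set Implicit Arguments.
Unset Strict Implicit.
Unset Printing Implicit Defensive.

Import Order.TTheory GRing.Theory Num.Theory.
Import numFieldNormedType.Exports.

Local Open Scope ring_scope.

Section Sekine.
Variables (R : realType) (n : nat).
Local Notation C := (complex R).

(* Everything below is meant for n >= 2: 'Z_n is Z/nZ only under that
   hypothesis. The matrix summand is indexed by 'Z_n as well, so that its index
   arithmetic is modulo n; row or column n of a matrix with rows and columns
   1, ..., n is the one at the residue 0. Sum, scaling, unit and product of KP
   are the componentwise ones. *)
Definition KP : Type :=
  ({ffun 'Z_n * 'Z_n -> C} * 'M[C]_((Zp_trunc n).+2))%type.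
HB.instance Definition _ := GRing.Lmodule.on KP.
HB.instance Definition _ := GRing.PzRing.on KP.

Implicit Types (x y a : KP) (i j s t m r : 'Z_n).

Definition eta : C :=
  (cos (2 * pi / n%:R) +i* sin (2 * pi / n%:R))%C.

(* Since eta ^+ n = 1, powers of eta are indexed by residues. *)
Definition etaX i : C := eta ^+ (i : nat).

Definition KPe i j : KP := ([ffun p => (p == (i, j))%:R], 0).

Definition KPE i j : KP := (0, delta_mx i j).

Definition KPstar x : KP :=
  ([ffun p => Num.conj (x.1 p)], \matrix_(i, j) Num.conj (x.2 j i)).

(* inl (i, j) labels e_(i,j) and inr (i, j) labels E_{i,j}. *)
Definition KPbase : finType := ('Z_n * 'Z_n + 'Z_n * 'Z_n)%type.

Definition KPvec (b : KPbase) : KP :=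
  match b with inl p => KPe p.1 p.2 | inr p => KPE p.1 p.2 end.

Definition KPcoord (b : KPbase) x : C :=
  match b with inl p => x.1 p | inr p => x.2 p.1 p.2 end.

(* KP ⊗ KP, in coordinates on the basis of the KPvec b ⊗ KPvec c. *)
Definition KPtensor : Type := {ffun KPbase * KPbase -> C}.

Definition tens x y : KPtensor :=
  [ffun p => KPcoord p.1 x * KPcoord p.2 y].

Definition comul_vec (b : KPbase) : KPtensor :=
  match b with
  | inl (i, j) =>
      \sum_s \sum_t tens (KPe s t) (KPe (i - s) (j - t))
      + n%:R^-1 *:
        \sum_m \sum_r etaX (i * (m - r)) *: tens (KPE m r) (KPE (m + j) (r + j))
  | inr (i, j) =>
      \sum_s \sum_t etaX (s * (i - j)) *:
        tens (KPe (- s) (- t)) (KPE (i - t) (j - t))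
      + \sum_s \sum_t etaX (s * (j - i)) *:
        tens (KPE (i - t) (j - t)) (KPe s t)
  end.

Definition comul x : KPtensor := \sum_b KPcoord b x *: comul_vec b.

Definition haar x : C :=
  (2 * n%:R ^+ 2)^-1 * (\sum_i \sum_j x.1 (i, j) + n%:R * \sum_i x.2 i i).

Lemma KPcoord_is_linear b : linear_for *%R (KPcoord b).
Proof. by move=> c x y; case: b => p /=; rewrite ?mxE ?ffunE. Qed.

Lemma haar_is_linear : linear_for *%R haar.
Proof.
move=> c x y; rewrite /haar [c * (_ * _)]mulrCA -mulrDr; congr (_ * _).
rewrite mulrDr addrACA; congr (_ + _).
  rewrite mulr_sumr -big_split; apply: eq_bigr => i _.
  by rewrite mulr_sumr -big_split; apply: eq_bigr => j _; rewrite !ffunE.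
rewrite mulrCA -mulrDr; congr (_ * _); rewrite mulr_sumr -big_split.
by apply: eq_bigr => i _; rewrite !mxE.
Qed.

HB.instance Definition _ :=
  GRing.isLinear.Build C KP C *%R haar haar_is_linear.

Definition fourier_fun a y : C := haar (y * a).

Lemma fourier_fun_is_linear a : linear_for *%R (fourier_fun a).
Proof.
move=> c x y; rewrite /fourier_fun mulrDl raddfD /=; congr (_ + _).
rewrite -linearZ; congr haar.
by congr pair; [apply/ffunP => p; rewrite !ffunE; exact: esym (mulrA _ _ _)
  | exact: esym (scalemxAl _ _ _)].
Qed.

HB.instance Definition _ a :=
  GRing.isLinear.Build C KP C *%R (fourier_fun a) (fourier_fun_is_linear a).

Definition fourier a : {scalar KP} := fourier_fun a.

Definition tensor_functional (phi psi : {scalar KP}) (z : KPtensor) : C :=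
  \sum_p z p * (phi (KPvec p.1) * psi (KPvec p.2)).

Definition convol_fun (phi psi : {scalar KP}) y : C :=
  tensor_functional phi psi (comul y).

Lemma convol_fun_is_linear phi psi : linear_for *%R (convol_fun phi psi).
Proof.
move=> c x y; rewrite /convol_fun /tensor_functional mulr_sumr -big_split /=.
apply: eq_bigr => p _; rewrite [c * _]mulrA -mulrDl; congr (_ * _).
rewrite /comul !sum_ffunE mulr_sumr -big_split /=.
apply: eq_bigr => b _.
rewrite KPcoord_is_linear !ffunE scalerDl; congr (_ + _).
exact: esym (mulrA _ _ _).
Qed.

HB.instance Definition _ phi psi := GRing.isLinear.Build C KP C *%R
  (convol_fun phi psi) (convol_fun_is_linear phi psi).

Definition convol (phi psi : {scalar KP}) : {scalar KP} := convol_fun phi psi.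

(* The counit, the neutral element of convol; it serves as the 0-th convolution
   power. *)
Definition counit_fun x : C := x.1 (0, 0).

Lemma counit_fun_is_linear : linear_for *%R counit_fun.
Proof. by move=> c x y; rewrite /counit_fun /= !ffunE. Qed.

HB.instance Definition _ :=
  GRing.isLinear.Build C KP C *%R counit_fun counit_fun_is_linear.

Definition counit : {scalar KP} := counit_fun.

Definition convol_pow (phi : {scalar KP}) (k : nat) : {scalar KP} :=
  iter k (convol phi) counit.

(* The dual space is finite-dimensional, so its only Hausdorff vector space
   topology is that of pointwise convergence. R[i]^o carries the topology of
   the modulus. *)
Definition dual_cvg (phi : nat -> {scalar KP}) : Prop :=
  exists l : {scalar KP}, forall y,
    ((fun k => phi k y) @ \oo --> (l y : C^o))%classic.

Definition adjoint d (u : 'M[KP]_d) : 'M[KP]_d := \matrix_(i, j) KPstar (u j i).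

Record representation := Representation {
  rdim : nat;
  rmx : 'M[KP]_rdim;
  _ : forall i j : 'I_rdim, comul (rmx i j) = \sum_k tens (rmx i k) (rmx k j);
  _ : adjoint rmx *m rmx = 1%:M /\ rmx *m adjoint rmx = 1%:M
}.

Implicit Types u v : representation.

Definition character u : KP := \tr (rmx u).

Definition scalar_entries p q (T : 'M[C]_(p, q)) : 'M[KP]_(p, q) :=
  map_mx (fun c => c *: (1 : KP)) T.

Definition intertwiner u v (T : 'M[C]_(rdim v, rdim u)) : Prop :=
  scalar_entries T *m rmx u = rmx v *m scalar_entries T.

Definition irreducible u : Prop :=
  (0 < rdim u)%N /\
  forall T : 'M[C]_(rdim u), intertwiner (v := u) T -> is_scalar_mx T.

Definition equivalent u v : Prop :=
  exists (T : 'M[C]_(rdim v, rdim u)) (S : 'M[C]_(rdim u, rdim v)),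
    [/\ T *m S = 1%:M, S *m T = 1%:M & intertwiner T].

(* I, through w, is a system of representatives of the equivalence classes of
   irreducible representations. *)
Definition irreducible_classes (I : finType) (w : I -> representation) : Prop :=
  [/\ forall alpha, irreducible (w alpha),
      forall alpha beta, equivalent (w alpha) (w beta) -> alpha = beta
    & forall u, irreducible u -> exists alpha, equivalent u (w alpha)].

End Sekine.

(* Main.v *)
From HB Require Import structures.
Require Import Defs.
From mathcomp Require Import all_boot all_order all_algebra.
From mathcomp Require Import all_classical all_reals all_analysis.
From mathcomp Require Import complex ring.

Set Implicit Arguments.
Unset Strict Implicit.
Unset Printing Implicit Defensive.

Import Order.TTheory GRing.Theory Num.Theory.
Import numFieldNormedType.Exports.

Local Open Scope ring_scope.

(* Write phi = F(a). Strong invariance of the Haar state says that, for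
   representations u and v, the matrix (haar (u_pj v_kl))_(p,k) intertwines u
   with the conjugate of v. By Schur's lemma it vanishes for irreducible u, v
   unless u is equivalent to the conjugate of v, in which case its value is
   forced by unitarity and traciality. Hence phi (u_ij) = (a_alpha / d_alpha)
   if i = j and 0 otherwise, where alpha is the class of the conjugate of u,
   and therefore phi^{*k} (u_ij) is the k-th power of that scalar on the
   diagonal. As conjugation permutes the classes, convergence forces every
   sequence (a_alpha / d_alpha)^k to converge. Conversely these sequences
   decide convergence everywhere, because the coefficients of irreducible
   representations span C(KP_n): by Fourier inversion on Z/n it is enough to
   look at X^{u,v}, which is irreducible when 2v <> 0 and splits into two
   one-dimensional representations when 2v = 0. *)

(** * Roots of unity *)

Section RootsOfUnity.
Variables (R : realType) (n : nat).
Hypothesis n_gt1 : (1 < n)%N.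
Local Notation X := (@etaX R n).
Local Notation eta := (eta R n).

Lemma eta_expE k : eta ^+ k =
  (cos (2 * pi / n%:R * k%:R) +i* sin (2 * pi / n%:R * k%:R))%C.
Proof.
elim: k => [|k IHk]; first by rewrite mulr0 cos0 sin0.
rewrite exprSr IHk /eta; simpc.
have -> : 2 * pi / n%:R * k.+1%:R = 2 * pi / n%:R * k%:R + 2 * pi / n%:R :> R.
  by rewrite -natr1; ring.
by rewrite cosD sinD [sin _ * cos _ + _]addrC.
Qed.

Lemma natn_neq0 (F : numDomainType) : n%:R != 0 :> F.
Proof. by rewrite pnatr_eq0 -lt0n ltnW. Qed.

Lemma eta_expn : eta ^+ n = 1.
Proof.
by rewrite eta_expE divfK ?natn_neq0 // mulr_natl cos2pi sin2pi.
Qed.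

(** The half-angle formula gives $\cos x-1=-2\sin^2(x/2)$, and the sine is positive on $(0,\pi)$. *)
Lemma cos_neq1 (x : R) : 0 < x -> x < 2 * pi -> cos x != 1.
Proof.
move=> x_gt0 x_lt2pi; have -> : x = (x / 2) *+ 2 by rewrite -mulr_natr divfK.
rewrite cos_mulr2n -subr_eq0 addrAC -mulr_natl.
have -> y : 2 * y ^+ 2 - 1 - 1 = - 2 * (1 - y ^+ 2) :> R by ring.
rewrite -sin2cos2 mulf_neq0 ?oppr_eq0 ?pnatr_eq0// expf_neq0// gt_eqF//.
by rewrite sin_gt0_pi// divr_gt0//= ltr_pdivrMr// mulrC.
Qed.

Lemma eta_exp_neq1 k : (0 < k < n)%N -> eta ^+ k != 1.
Proof.
move=> /andP[k_gt0 ltkn]; rewrite eta_expE eq_complex negb_and /=.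
rewrite cos_neq1 //.
  by rewrite !mulr_gt0 ?invr_gt0 ?pi_gt0 ?ltr0n// ltnW.
rewrite -[ltRHS]mulr1 -mulrA ltr_pM2l ?mulr_gt0 ?pi_gt0//.
by rewrite mulrC ltr_pdivrMr ?mul1r ?ltr_nat// ltr0n ltnW.
Qed.

(** The residue [i + j] is reduced modulo $n$, which does no harm because $\eta^n=1$. *)
Lemma etaXD i j : X (i + j) = X i * X j.
Proof.
have etaN : eta ^+ (Zp_trunc n).+2 = 1 by rewrite Zp_cast // eta_expn.
by rewrite /etaX -exprD /= expr_mod.
Qed.

Lemma etaX0 : X 0 = 1. Proof. by rewrite /etaX expr0. Qed.

Lemma etaX_eq1 k : (X k == 1) = (k == 0).
Proof.
have [->|k0] := eqVneq k 0; first by rewrite etaX0 eqxx.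
have ltkn : (k < n)%N by rewrite -[ltnRHS](Zp_cast n_gt1) ltn_ord.
by apply/negbTE/eta_exp_neq1; rewrite ltkn andbT lt0n.
Qed.

Lemma etaXNr i : X i * X (- i) = 1.
Proof. by rewrite -etaXD subrr etaX0. Qed.

Lemma conj_etaX i : Num.conj (X i) = X (- i).
Proof.
have nX : Num.conj (X i) * X i = 1.
  rewrite /etaX rmorphXn -exprMn mulrC.
  have -> : eta * Num.conj eta = 1.
    rewrite -[X in _ * X]/(conjc eta) /eta; simpc.
    by rewrite -!expr2 cos2Dsin2 [sin _ * _]mulrC addNr.
  by rewrite expr1n.
by rewrite -[LHS]mulr1 -(etaXNr i) mulrA nX mul1r.
Qed.

(** Translating the summation index by 1 multiplies the sum by [X k], so the sum vanishes unless
    [X k] is 1. *)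
Lemma sum_etaX k : \sum_i X (i * k) = n%:R * (k == 0)%:R.
Proof.
have [->|k0] := eqVneq k 0.
  under eq_bigr do rewrite mulr0 etaX0.
  by rewrite sumr_const card_ord Zp_cast // mulr1.
rewrite mulr0; apply/eqP; have : (X k - 1) * \sum_i X (i * k) == 0.
  rewrite mulrBl mul1r subr_eq0 [eqbRHS](reindex_inj (addrI 1)) mulr_sumr.
  by apply/eqP/eq_bigr => i _; rewrite mulrDl mul1r etaXD.
by rewrite mulf_eq0 subr_eq0 etaX_eq1 (negPf k0).
Qed.

End RootsOfUnity.

(** * The Hopf algebra structure in coordinates *)

Section HopfAlgebra.
Variables (R : realType) (n : nat).
Hypothesis n_gt1 : (1 < n)%N.
Local Notation C := (complex R).
Local Notation X := (@etaX R n).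
Local Notation KP := (KP R n).
Implicit Types (a b c d : KPbase n) (x y z : KP).

Definition pair_swap (p : 'Z_n * 'Z_n) := (p.2, p.1).
Definition diag_shift (p : 'Z_n * 'Z_n) (t : 'Z_n) := (p.1 + t, p.2 + t).

(** The antipode of $\mathbb{KP}_n$ permutes the standard basis, so a permutation of labels encodes
    it. *)
Definition base_antipode a : KPbase n :=
  match a with inl p => inl (- p) | inr p => inr (pair_swap p) end.

Definition base_star a : KPbase n :=
  match a with inl p => inl p | inr p => inr (pair_swap p) end.

(** The Haar state of [KPvec a] times its adjoint; for a matrix unit this is the value at
    $E_{i,i}$. *)
Definition haar_weight a : C :=
  match a with inl _ => (2 * n%:R ^+ 2)^-1 | inr _ => (2 * n%:R)^-1 end.

(* The coefficient of KPvec b ⊗ KPvec c in the coproduct of KPvec a. *)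
Definition comul_coef a b c : C :=
  match a, b, c with
  | inl p, inl q, inl r => (q + r == p)%:R
  | inl p, inr q, inr r =>
      n%:R^-1 * (X (p.1 * (q.1 - q.2)) * (r == diag_shift q p.2)%:R)
  | inr p, inl q, inr r => X (q.1 * (p.2 - p.1)) * (r == diag_shift p q.2)%:R
  | inr p, inr q, inl r => X (r.1 * (p.2 - p.1)) * (p == diag_shift q r.2)%:R
  | _, _, _ => 0
  end.

Lemma base_antipodeK : involutive base_antipode.
Proof. by case=> [p|[i j]] //=; rewrite opprK. Qed.

Lemma base_starK : involutive base_star.
Proof. by case=> [p|[i j]]. Qed.

Lemma haar_weight_star a : haar_weight (base_star a) = haar_weight a.
Proof. by case: a. Qed.

Lemma KPcoordE x y : (forall a, KPcoord a x = KPcoord a y) -> x = y.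
Proof.
move=> exy; case: x y exy => [x1 x2] [y1 y2] exy; congr (_, _).
  by apply/ffunP => p; exact: (exy (inl p)).
by apply/matrixP => i j; exact: (exy (inr (i, j))).
Qed.

Lemma KPcoord_vec a b : KPcoord a (KPvec R b) = (a == b)%:R.
Proof.
case: a b => [p|[i j]] [[k l]|[k l]] //=; rewrite ?ffunE ?mxE //.
Qed.

Lemma KPcoord_sum (I : Type) (r : seq I) (P : pred I) (F : I -> KP) a :
  KPcoord a (\sum_(i <- r | P i) F i) = \sum_(i <- r | P i) KPcoord a (F i).
Proof.
by apply: (big_morph (KPcoord a)) => [x y|];
  case: a => p /=; rewrite ?ffunE ?mxE.
Qed.

Lemma KPcoordZ a (l : C) x : KPcoord a (l *: x) = l * KPcoord a x.
Proof. by case: a => p /=; rewrite ?ffunE ?mxE. Qed.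

Lemma KPcoordD a x y : KPcoord a (x + y) = KPcoord a x + KPcoord a y.
Proof. by case: a => p /=; rewrite ?ffunE ?mxE. Qed.

Lemma KPvec_sum x : x = \sum_a KPcoord a x *: KPvec R a.
Proof.
apply: KPcoordE => a; rewrite KPcoord_sum (bigD1 a) //= big1 => [|b ba].
  by rewrite KPcoordZ KPcoord_vec eqxx mulr1 addr0.
by rewrite KPcoordZ KPcoord_vec eq_sym (negPf ba) mulr0.
Qed.

Lemma big_KPbase (F : KPbase n -> C) :
  \sum_a F a = \sum_p F (inl p) + \sum_p F (inr p).
Proof. exact: big_sumType. Qed.

Lemma sum_pair (F : 'Z_n * 'Z_n -> C) :
  \sum_p F p = \sum_i \sum_j F (i, j).
Proof. by rewrite pair_big; apply: eq_bigr => -[]. Qed.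

Lemma sum_eqr (T : finType) (t : T) (F : T -> C) :
  \sum_s F s * (t == s)%:R = F t.
Proof.
rewrite (bigD1 t) //= eqxx mulr1 big1 ?addr0 // => s st.
by rewrite eq_sym (negPf st) mulr0.
Qed.

Lemma tens_vec a b c d :
  tens (KPvec R a) (KPvec R b) (c, d) = (c == a)%:R * (d == b)%:R.
Proof. by rewrite ffunE !KPcoord_vec. Qed.

Lemma tensE x y a b : tens x y (a, b) = KPcoord a x * KPcoord b y.
Proof. by rewrite ffunE. Qed.

Lemma sum2_eqr (q : 'Z_n * 'Z_n) (F : 'Z_n -> 'Z_n -> C) :
  \sum_s \sum_t F s t * (q == (s, t))%:R = F q.1 q.2.
Proof.
rewrite pair_big -(sum_eqr q (fun p => F p.1 p.2)).
by apply: eq_bigr => -[].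
Qed.

(** At a fixed pair of coordinates each double sum has at most one nonzero term; a Kronecker symbol
    selects it. *)
Lemma comul_vecE a b c : comul_vec R a (b, c) = comul_coef a b c.
Proof.
have eE k l : KPe R k l = KPvec R (inl (k, l)) :> KP by [].
have EE k l : KPE R k l = KPvec R (inr (k, l)) :> KP by [].
have sE : (forall p q : 'Z_n * 'Z_n, (inl p == inl q :> KPbase n) = (p == q))
  * (forall p q : 'Z_n * 'Z_n, (inr p == inr q :> KPbase n) = (p == q))
  * (forall p q : 'Z_n * 'Z_n, (inl p == inr q :> KPbase n) = false)
  * (forall p q : 'Z_n * 'Z_n, (inr p == inl q :> KPbase n) = false) by [].
have sum0 (F : 'Z_n -> 'Z_n -> C) :
  (forall s t, F s t = 0) -> \sum_s \sum_t F s t = 0.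
  by move=> F0; rewrite big1 // => s _; rewrite big1.
have sumE q (F G : 'Z_n -> 'Z_n -> C) :
  (forall s t, F s t = G s t * (q == (s, t))%:R) ->
  \sum_s \sum_t F s t = G q.1 q.2.
  move=> FG; rewrite -(sum2_eqr q G).
  by apply: eq_bigr => s _; apply: eq_bigr.
case: a => -[i j]; rewrite /comul_vec !ffunE !sum_ffunE.
  under eq_bigr do rewrite sum_ffunE.
  under [in X in _ + X]eq_bigr do rewrite sum_ffunE.
  under eq_bigr do under eq_bigr do rewrite eE eE tens_vec.
  under [in X in _ + X]eq_bigr do under eq_bigr do rewrite EE EE ffunE tens_vec.
  case: b c => [q|q] [r|r].
  - rewrite (sumE q _ (fun s t => (r == (i - s, j - t))%:R)); last first.
      by move=> s t; rewrite !sE mulrC.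
    rewrite sum0 => [|s t]; last by rewrite !sE mul0r scaler0.
    rewrite scaler0 addr0 /= -[(_, _)]/((i, j) - q).
    by rewrite eq_sym subr_eq eq_sym addrC.
  - rewrite !sum0 => [|s t|s t]; rewrite ?sE ?mulr0 ?mul0r ?scaler0 //.
    by rewrite /= addr0.
  - rewrite !sum0 => [|s t|s t]; rewrite ?sE ?mulr0 ?mul0r ?scaler0 //.
    by rewrite /= addr0.
  - rewrite sum0 => [|s t]; last by rewrite !sE mul0r.
    rewrite (sumE q _ (fun s t => X (i * (s - t)) * (r == (s + j, t + j))%:R)).
      by rewrite add0r.
    by move=> s t; rewrite !sE -mulrA [X in _ = _ * X]mulrC.
under eq_bigr do rewrite sum_ffunE.
under [in X in _ + X]eq_bigr do rewrite sum_ffunE.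
under eq_bigr do under eq_bigr do rewrite eE EE ffunE tens_vec.
under [in X in _ + X]eq_bigr do under eq_bigr do rewrite EE eE ffunE tens_vec.
case: b c => [q|q] [r|r].
- by rewrite !sum0 => [|s t|s t]; rewrite ?sE ?mulr0 ?mul0r ?scaler0 /= ?addr0.
- rewrite [X in _ + X]sum0 => [|s t]; last by rewrite !sE mulr0 scaler0.
  (* The sum runs over $e_{(-s,-t)}$; negating both indices puts the Kronecker symbol in the form
     that [sumE] expects. *)
  rewrite addr0 (reindex_inj oppr_inj) /=.
  under eq_bigr do rewrite (reindex_inj oppr_inj) /=.
  rewrite (sumE q _ (fun s t => X (s * (j - i)) * (r == (i + t, j + t))%:R)) //.
  move=> s t; rewrite !sE !opprK -mulrA [X in _ = _ * X]mulrC.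
  by rewrite mulNr -mulrN opprB.
- rewrite [X in X + _]sum0 => [|s t]; last by rewrite !sE mul0r scaler0.
  rewrite add0r.
  rewrite (sumE r _ (fun s t => X (s * (j - i)) * (q == (i - t, j - t))%:R)).
    congr (_ * _%:R); rewrite -[(_, _)]/((i, j) - (r.2, r.2)).
    by rewrite eq_sym subr_eq.
  by move=> s t; rewrite !sE -mulrA.
- by rewrite !sum0 => [|s t|s t]; rewrite ?sE ?mulr0 ?mul0r ?scaler0 /= ?addr0.
Qed.

Lemma comulE x b c :
  comul x (b, c) = \sum_a KPcoord a x * comul_coef a b c.
Proof.
by rewrite /comul sum_ffunE; apply: eq_bigr => a _; rewrite ffunE comul_vecE.
Qed.

(** Compares two terms carrying Kronecker symbols: the coefficients only have to agree where the
    symbols do not vanish. *)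
Lemma mul_bool_congr (P Q : bool) (f g : C) :
  P = Q -> (P -> f = g) -> f * P%:R = g * Q%:R.
Proof. by move=> <-; case: P => [->//|]; rewrite !mulr0. Qed.

(* Strong invariance of the Haar state, on basis vectors:
   (id ⊗ haar)(Delta(x)(1 ⊗ y)) = S((id ⊗ haar)((1 ⊗ x)Delta(y))). It makes
   Schur averaging possible without the multiplicativity of Delta. *)
Lemma comul_coef_strong a b c :
  comul_coef a b (base_star c) * haar_weight c =
  comul_coef c (base_antipode b) (base_star a) * haar_weight a.
Proof.
have nC := natn_neq0 n_gt1 C.
case: a b c => [[a1 a2]|[a1 a2]] [[b1 b2]|[b1 b2]] [[c1 c2]|[c1 c2]];
  rewrite /= ?mul0r // !xpair_eqE /= 1?[LHS]mulrC 1?[RHS]mulrC ?mulrA.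
- apply: mul_bool_congr => //.
  by apply/idP/idP => /andP[/eqP <- /eqP <-];
    apply/andP; split; apply/eqP; ring.
- apply: mul_bool_congr; last first.
    by move=> /andP[/eqP-> /eqP->]; rewrite opprD addrACA subrr addr0; field.
  by apply/idP/idP => /andP[/eqP -> /eqP ->];
    apply/andP; split; apply/eqP; ring.
- apply: mul_bool_congr; last first.
    move=> /andP[/eqP-> /eqP->]; congr (_ * X _); ring.
  by apply/idP/idP => /andP[/eqP -> /eqP ->];
    apply/andP; split; apply/eqP; ring.
- apply: mul_bool_congr; last first.
    by move=> /andP[/eqP-> /eqP->]; rewrite opprD addrACA subrr addr0; field.
  by apply/idP/idP => /andP[/eqP -> /eqP ->];
    apply/andP; split; apply/eqP; ring.
Qed.

(** The antipode reverses the coproduct: $\Delta\circ S=\sigma\circ(S\otimes S)\circ\Delta$ with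
    $\sigma$ the flip. *)
Lemma comul_coef_antipode a b c :
  comul_coef (base_antipode a) (base_antipode c) (base_antipode b) =
  comul_coef a b c.
Proof.
case: a b c => [[a1 a2]|[a1 a2]] [[b1 b2]|[b1 b2]] [[c1 c2]|[c1 c2]] //=;
  rewrite !xpair_eqE /=.
- by rewrite -!opprD !eqr_opp ![c1 + _]addrC ![c2 + _]addrC.
- congr (_ * _); apply: mul_bool_congr; last first.
    by move=> /andP[/eqP-> /eqP->]; congr (X _); ring.
  by apply/idP/idP => /andP[/eqP -> /eqP ->];
    apply/andP; split; apply/eqP; ring.
- apply: mul_bool_congr; last by move=> _; congr (X _); ring.
  by apply/idP/idP => /andP[/eqP -> /eqP ->];
    apply/andP; split; apply/eqP; ring.
- apply: mul_bool_congr; last by move=> _; congr (X _); ring.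
  by apply/idP/idP => /andP[/eqP -> /eqP ->];
    apply/andP; split; apply/eqP; ring.
Qed.

(** The counit axiom $(\varepsilon\otimes\mathrm{id})\Delta=\mathrm{id}$, where $\varepsilon$ reads
    off the coordinate at $e_{(0,0)}$. *)
Lemma comul_coef_counit a c : comul_coef a (inl (0, 0)) c = (a == c)%:R.
Proof.
case: a c => [[a1 a2]|[a1 a2]] [[c1 c2]|[c1 c2]] //=; rewrite eq_sym.
  by rewrite -[(0, 0)]/(0 : 'Z_n * 'Z_n) add0r.
by rewrite mul0r etaX0 mul1r /diag_shift /= !addr0.
Qed.

(** The antipode axiom $m(S\otimes\mathrm{id})\Delta=\varepsilon(\cdot)1$ at a coordinate of the
    commutative summand, where products are pointwise. *)
Lemma comul_coef_antipode_inl a p :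
  comul_coef a (inl (- p)) (inl p) = (a == inl (0, 0))%:R.
Proof. by case: a => [q|q] //=; rewrite addNr eq_sym. Qed.

(** The antipode axiom at an entry of the matrix summand. The sum over [m] comes from the matrix
    product; it is a character sum, whose value $n$ or $0$ meets the factor $1/n$ of the
    coproduct. *)
Lemma comul_coef_antipode_inr a i j :
  \sum_m comul_coef a (inr (m, i)) (inr (m, j)) =
  (a == inl (0, 0))%:R * (i == j)%:R.
Proof.
case: a => [[a1 a2]|q] /=; last by rewrite big1 // mul0r.
rewrite -[inl _ == inl _]/((a1, a2) == (0, 0)) xpair_eqE.
under eq_bigr do rewrite xpair_eqE -subr_eq0 opprD addrA subrr sub0r oppr_eq0.
have [->|a2_neq0] := eqVneq a2 0; last first.
  by rewrite andbF mul0r big1 // => m _; rewrite !mulr0.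
rewrite andbT /=.
have nC := natn_neq0 n_gt1 C.
have := sum_etaX R n_gt1 a1; rewrite (reindex_inj (addIr (- i))) /=.
under [X in X = _ -> _]eq_bigr do rewrite mulrC.
move=> sX; rewrite -mulr_sumr -mulr_suml sX -mulrA mulKf // addr0.
by rewrite [j == i]eq_sym.
Qed.

Lemma KPcoordM_inl x y p :
  KPcoord (inl p) (x * y) = KPcoord (inl p) x * KPcoord (inl p) y.
Proof. by rewrite /= ffunE. Qed.

Lemma KPcoordM_inr x y i j : KPcoord (inr (i, j)) (x * y) =
  \sum_k KPcoord (inr (i, k)) x * KPcoord (inr (k, j)) y.
Proof. by rewrite /= mxE. Qed.

Lemma KPcoord1_inl p : KPcoord (inl p) (1 : KP) = 1.
Proof. by rewrite /= ffunE. Qed.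

Lemma KPcoord1_inr i j : KPcoord (inr (i, j)) (1 : KP) = (i == j)%:R.
Proof. by rewrite /= mxE. Qed.

Lemma haarM x y : haar (x * y) =
  \sum_a haar_weight a * (KPcoord a x * KPcoord (base_star a) y).
Proof.
have nC := natn_neq0 n_gt1 C.
rewrite big_KPbase /haar mulrDr mulr_sumr sum_pair; congr (_ + _).
  apply: eq_bigr => i _; rewrite mulr_sumr; apply: eq_bigr => j _ /=.
  by rewrite ffunE.
rewrite mulrA mulr_sumr sum_pair; apply: eq_bigr => i _.
rewrite mxE mulr_sumr; apply: eq_bigr => j _ /=.
by congr (_ * _); field.
Qed.

Lemma KPcoord_natr (k : bool) a :
  KPcoord a (k%:R : KP) = k%:R * KPcoord a (1 : KP).
Proof.
case: k; rewrite ?mul1r ?mul0r //.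
by case: a => p /=; rewrite ?ffunE ?mxE.
Qed.

(** In [haarM] the relabelling [base_star] exchanges the roles of the two factors and preserves the
    weights. *)
Lemma haarC x y : haar (x * y) = haar (y * x).
Proof.
rewrite !haarM (reindex_inj (inv_inj base_starK)); apply: eq_bigr => a _.
by rewrite base_starK haar_weight_star [_ * KPcoord a y]mulrC.
Qed.

Lemma haar1 : haar (1 : KP) = 1.
Proof.
have nC := natn_neq0 n_gt1 C.
rewrite /haar; under eq_bigr do under eq_bigr do rewrite ffunE.
under [X in _ + _ * X]eq_bigr do rewrite mxE eqxx.
rewrite sumr_const card_ord sumr_const card_ord Zp_cast // -mulr_natr; field.
by [].
Qed.

Lemma KPscaleAl (l : C) x y : l *: x * y = l *: (x * y).
Proof.
apply: KPcoordE => -[p|[i j]]; rewrite KPcoordZ.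
  by rewrite !KPcoordM_inl KPcoordZ mulrA.
rewrite !KPcoordM_inr mulr_sumr.
by apply: eq_bigr => k _; rewrite KPcoordZ mulrA.
Qed.

Lemma KPscaleAr (l : C) x y : x * (l *: y) = l *: (x * y).
Proof.
apply: KPcoordE => -[p|[i j]]; rewrite KPcoordZ.
  by rewrite !KPcoordM_inl KPcoordZ mulrCA.
rewrite !KPcoordM_inr mulr_sumr.
by apply: eq_bigr => k _; rewrite KPcoordZ mulrCA.
Qed.

(** * The antipode and the involution on vectors *)

Definition antipode x : KP := ([ffun p => x.1 (- p.1, - p.2)], x.2^T).

Lemma KPcoord_antipode a x :
  KPcoord a (antipode x) = KPcoord (base_antipode a) x.
Proof. by case: a => [p|[i j]] /=; rewrite ?ffunE ?mxE. Qed.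

Lemma antipodeK : involutive antipode.
Proof.
by move=> x; apply: KPcoordE => a; rewrite !KPcoord_antipode base_antipodeK.
Qed.

Lemma antipodeM x y : antipode (x * y) = antipode y * antipode x.
Proof.
apply: KPcoordE => -[p|[i j]]; rewrite KPcoord_antipode.
  by rewrite !KPcoordM_inl !KPcoord_antipode mulrC.
rewrite !KPcoordM_inr; apply: eq_bigr => k _.
by rewrite !KPcoord_antipode mulrC.
Qed.

Lemma antipode_sum (I : Type) (r : seq I) (P : pred I) (F : I -> KP) :
  antipode (\sum_(i <- r | P i) F i) = \sum_(i <- r | P i) antipode (F i).
Proof.
apply: KPcoordE => a; rewrite KPcoord_antipode !KPcoord_sum.
by apply: eq_bigr => i _; rewrite KPcoord_antipode.
Qed.

Lemma antipode_natr (k : bool) : antipode k%:R = k%:R.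
Proof.
apply: KPcoordE => a; rewrite KPcoord_antipode !KPcoord_natr.
by case: a => [p|[i j]] /=; rewrite ?ffunE ?mxE 1?eq_sym.
Qed.

Lemma KPcoord_star a x :
  KPcoord a (KPstar x) = Num.conj (KPcoord (base_star a) x).
Proof. by case: a => [p|[i j]] /=; rewrite ?ffunE ?mxE. Qed.

Lemma KPstarK : involutive (@KPstar R n).
Proof.
by move=> x; apply: KPcoordE => a; rewrite !KPcoord_star base_starK conjCK.
Qed.

Lemma KPstarM x y : KPstar (x * y) = KPstar y * KPstar x.
Proof.
apply: KPcoordE => -[p|[i j]]; rewrite KPcoord_star.
  by rewrite !KPcoordM_inl !KPcoord_star rmorphM mulrC.
rewrite !KPcoordM_inr rmorph_sum; apply: eq_bigr => k _.
by rewrite !KPcoord_star rmorphM mulrC.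
Qed.

Lemma KPstar_sum (I : Type) (r : seq I) (P : pred I) (F : I -> KP) :
  KPstar (\sum_(i <- r | P i) F i) = \sum_(i <- r | P i) KPstar (F i).
Proof.
apply: KPcoordE => a; rewrite KPcoord_star !KPcoord_sum rmorph_sum.
by apply: eq_bigr => i _; rewrite KPcoord_star.
Qed.

Lemma KPstarZ (l : C) x : KPstar (l *: x) = Num.conj l *: KPstar x.
Proof.
by apply: KPcoordE => a; rewrite KPcoord_star !KPcoordZ KPcoord_star rmorphM.
Qed.

Lemma KPstar0 : KPstar (0 : KP) = 0.
Proof. by rewrite -[X in KPstar X](scale0r 0) KPstarZ rmorph0 scale0r. Qed.

Lemma KPstar1 : KPstar (1 : KP) = 1.
Proof.
apply: KPcoordE => a; rewrite KPcoord_star.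
by case: a => [p|[i j]] /=; rewrite ?ffunE ?mxE 1?eq_sym ?rmorph1 ?rmorph_nat.
Qed.

End HopfAlgebra.

(** * Schur orthogonality *)

Section Representations.
Variables (R : realType) (n : nat).
Hypothesis n_gt1 : (1 < n)%N.
Local Notation C := (complex R).
Local Notation KP := (KP R n).
Implicit Types (a b c : KPbase n) (x y z : KP).
Implicit Types (u v w : representation R n).

Local Notation "T %:KP" := (scalar_entries n T) (at level 1, format "T %:KP").

(** * Matrices over the algebra and over the scalars *)

Lemma mul_scalar_entries p q r (T : 'M[C]_(p, q)) (S : 'M[C]_(q, r)) :
  (T *m S)%:KP = T%:KP *m S%:KP.
Proof.
apply/matrixP => i j; rewrite !mxE scaler_suml; apply: eq_bigr => k _.
by rewrite !mxE KPscaleAl mul1r scalerA.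
Qed.

Lemma scalar_entries_scalar p (l : C) :
  (l%:M : 'M[C]_p)%:KP = (l *: (1 : KP))%:M.
Proof.
by apply/matrixP => i j; rewrite !mxE; case: (i == j); rewrite ?scale0r.
Qed.

Lemma scalar_entries1 p : (1%:M : 'M[C]_p)%:KP = 1%:M :> 'M[KP]_p.
Proof. by rewrite scalar_entries_scalar scale1r. Qed.

Lemma mulE_l p q r (T : 'M[C]_(p, q)) (A : 'M[KP]_(q, r)) i j :
  (T%:KP *m A) i j = \sum_k T i k *: A k j.
Proof.
by rewrite mxE; apply: eq_bigr => k _; rewrite mxE KPscaleAl mul1r.
Qed.

Lemma mulE_r p q r (A : 'M[KP]_(p, q)) (T : 'M[C]_(q, r)) i j :
  (A *m T%:KP) i j = \sum_k T k j *: A i k.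
Proof.
by rewrite mxE; apply: eq_bigr => k _; rewrite mxE KPscaleAr mulr1.
Qed.

(** Extends [adjoint] to rectangular matrices, for use on intertwiners. *)
Definition hadj p q (A : 'M[KP]_(p, q)) : 'M[KP]_(q, p) :=
  \matrix_(i, j) KPstar (A j i).

Lemma hadjM p q r (A : 'M[KP]_(p, q)) (B : 'M[KP]_(q, r)) :
  hadj (A *m B) = hadj B *m hadj A.
Proof.
apply/matrixP => i j; rewrite !mxE KPstar_sum; apply: eq_bigr => k _.
by rewrite !mxE KPstarM.
Qed.

Definition ctr p q (T : 'M[C]_(p, q)) : 'M[C]_(q, p) :=
  \matrix_(i, j) Num.conj (T j i).

Lemma hadj_scalar p q (T : 'M[C]_(p, q)) : hadj T%:KP = (ctr T)%:KP.
Proof. by apply/matrixP => i j; rewrite !mxE KPstarZ KPstar1. Qed.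

Lemma ctr_mul_diag p q (T : 'M[C]_(p, q)) i :
  (ctr T *m T) i i = \sum_k `|T k i| ^+ 2.
Proof. by rewrite mxE; apply: eq_bigr => k _; rewrite mxE normCK mulrC. Qed.

(** The diagonal entries of $T^*T$ are the sums of squared moduli over the columns of $T$. *)
Lemma ctr_mul_eq0 p q (T : 'M[C]_(p, q)) : ctr T *m T = 0 -> T = 0.
Proof.
move=> T0; apply/matrixP => i j; rewrite mxE.
have /eqP := ctr_mul_diag T j; rewrite T0 mxE eq_sym psumr_eq0; last first.
  by move=> k _; rewrite exprn_ge0.
by move=> /allP/(_ i (mem_index_enum _)); rewrite /= sqrf_eq0 normr_eq0 => /eqP.
Qed.

(** * Counit and antipode on representations *)

Lemma rep_comul u i j :
  comul (rmx u i j) = \sum_k tens (rmx u i k) (rmx u k j).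
Proof. by case: u i j => d m /= h _. Qed.

Lemma rep_unitl u : hadj (rmx u) *m rmx u = 1%:M.
Proof. by case: u => d m /= _ []. Qed.

Lemma rep_unitr u : rmx u *m hadj (rmx u) = 1%:M.
Proof. by case: u => d m /= _ []. Qed.

Lemma rep_comulE u i j b c :
  \sum_k KPcoord b (rmx u i k) * KPcoord c (rmx u k j) =
  \sum_a KPcoord a (rmx u i j) * comul_coef R a b c.
Proof.
rewrite -comulE // rep_comul sum_ffunE.
by apply: eq_bigr => k _; rewrite tensE.
Qed.

(** Let $T$ be the counit applied entrywise to $u$. The counit axiom gives $Tu=u$, and cancelling
    the invertible matrix $u$ leaves $T=1$. *)
Lemma rep_counit u i j : KPcoord (inl (0, 0)) (rmx u i j) = (i == j)%:R.
Proof.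
set U := rmx u; pose T := \matrix_(k, l) KPcoord (inl (0, 0)) (U k l).
have TU : T%:KP *m U = U.
  apply/matrixP => k l; apply: KPcoordE => c; rewrite mulE_l KPcoord_sum.
  under eq_bigr do rewrite KPcoordZ mxE.
  rewrite rep_comulE; under eq_bigr do rewrite comul_coef_counit // eq_sym.
  by rewrite sum_eqr.
have T1 : T%:KP = 1%:M.
  by rewrite -[T%:KP]mulmx1 -rep_unitr mulmxA TU.
have /matrixP/(_ i j)/(congr1 (KPcoord (inl (0, 0)))) := T1.
by rewrite !mxE KPcoordZ KPcoord_natr KPcoord1_inl !mulr1.
Qed.

(** By the antipode axiom the entrywise antipode of $u$ is a left inverse of $u$, so it equals the
    right inverse $u^*$. *)
Lemma rep_antipode u i j : antipode (rmx u i j) = KPstar (rmx u j i).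
Proof.
set U := rmx u; pose S := \matrix_(k, l) antipode (U k l).
have SU : S *m U = 1%:M.
  apply/matrixP => k l; apply: KPcoordE => a.
  rewrite !mxE KPcoord_sum KPcoord_natr; case: a => [p|[p q]].
    under eq_bigr do rewrite KPcoordM_inl mxE KPcoord_antipode.
    rewrite rep_comulE; under eq_bigr do rewrite comul_coef_antipode_inl eq_sym.
    by rewrite sum_eqr rep_counit KPcoord1_inl mulr1.
  under eq_bigr do rewrite KPcoordM_inr.
  rewrite exchange_big.
  under eq_bigr do under eq_bigr do rewrite mxE KPcoord_antipode.
  under eq_bigr do rewrite rep_comulE.
  rewrite exchange_big; under eq_bigr do rewrite -mulr_sumr.
  under eq_bigr do rewrite comul_coef_antipode_inr // eq_sym mulrA.
  by rewrite -mulr_suml sum_eqr rep_counit KPcoord1_inr.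
have : S = hadj U by rewrite -[S]mulmx1 -(rep_unitr u) mulmxA SU mul1mx.
by move=> /matrixP/(_ i j); rewrite !mxE.
Qed.

(** * The conjugate representation *)

Definition conj_mx u : 'M[KP]_(rdim u) := \matrix_(i, j) KPstar (rmx u i j).

Lemma conj_mxE u i j : conj_mx u i j = antipode (rmx u j i).
Proof. by rewrite mxE rep_antipode. Qed.

(** The entries are $S(u_{ji})$: the antipode reverses the coproduct and the transposition reverses
    it back. *)
Lemma conj_mx_comul u i j :
  comul (conj_mx u i j) = \sum_k tens (conj_mx u i k) (conj_mx u k j).
Proof.
apply/ffunP => -[b c]; rewrite comulE // sum_ffunE.
rewrite (reindex_inj (inv_inj (@base_antipodeK n))) /=.
transitivity (\sum_a KPcoord a (rmx u j i) *
    comul_coef R a (base_antipode c) (base_antipode b)).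
  apply: eq_bigr => a _; rewrite conj_mxE KPcoord_antipode base_antipodeK.
  congr (_ * _); rewrite -[RHS]comul_coef_antipode //.
  by rewrite !base_antipodeK.
rewrite -rep_comulE; apply: eq_bigr => k _.
by rewrite tensE !conj_mxE !KPcoord_antipode mulrC.
Qed.

(** Entrywise conjugation does not respect products of matrices over a noncommutative algebra. Since
    the antipode reverses products, each unitarity relation is the antipode of the opposite relation
    for $u$, transposed. *)
Lemma conj_mx_unitary u :
  hadj (conj_mx u) *m conj_mx u = 1%:M /\ conj_mx u *m hadj (conj_mx u) = 1%:M.
Proof.
have hE i j : hadj (conj_mx u) i j = antipode (hadj (rmx u) j i).
  by rewrite !mxE KPstarK -rep_antipode antipodeK.
split; apply/matrixP => i j; rewrite [LHS]mxE.
  transitivity (antipode ((rmx u *m hadj (rmx u)) j i)); last first.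
    by rewrite rep_unitr mxE antipode_natr mxE eq_sym.
  rewrite mxE antipode_sum; apply: eq_bigr => k _.
  by rewrite hE conj_mxE antipodeM.
transitivity (antipode ((hadj (rmx u) *m rmx u) j i)); last first.
  by rewrite rep_unitl mxE antipode_natr mxE eq_sym.
rewrite mxE antipode_sum; apply: eq_bigr => k _.
by rewrite hE conj_mxE antipodeM.
Qed.

Definition conj_rep u : representation R n :=
  Representation (@conj_mx_comul u) (conj_mx_unitary u).

Lemma conj_repK u : rmx (conj_rep (conj_rep u)) = rmx u.
Proof. by apply/matrixP => i j; rewrite !mxE KPstarK. Qed.

Lemma conj_repE u (i j : 'I_(rdim u)) :
  rmx (conj_rep u) i j = KPstar (rmx u i j).
Proof. exact: mxE. Qed.

(** * Intertwiners, equivalence and Schur's lemma *)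

Lemma intertwinerP u v (T : 'M[C]_(rdim v, rdim u)) :
  intertwiner T <-> forall i j,
    \sum_k T i k *: rmx u k j = \sum_k T k j *: rmx v i k.
Proof.
split=> [/matrixP uT i j|uT]; first by rewrite -mulE_l uT mulE_r.
by apply/matrixP => i j; rewrite mulE_l mulE_r uT.
Qed.

Lemma intertwiner_comp u v w (T : 'M[C]_(rdim v, rdim u))
    (S : 'M[C]_(rdim w, rdim v)) :
  intertwiner T -> intertwiner S -> intertwiner (S *m T).
Proof.
rewrite /intertwiner => uT vS.
by rewrite mul_scalar_entries -mulmxA uT mulmxA vS mulmxA.
Qed.

(** The adjoint of $Tu=vT$ is $u^*T^*=T^*v^*$; multiply by $u$ on the left and by $v$ on the
    right. *)
Lemma intertwiner_ctr u v (T : 'M[C]_(rdim v, rdim u)) :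
  intertwiner T -> intertwiner (u := v) (v := u) (ctr T).
Proof.
rewrite /intertwiner => /(congr1 (fun A => rmx u *m hadj A *m rmx v)).
rewrite !hadjM hadj_scalar !mulmxA rep_unitr mul1mx => ->.
by rewrite -[LHS]mulmxA rep_unitl mulmx1.
Qed.

Lemma equivalent_sym u v : equivalent u v -> equivalent v u.
Proof.
move=> [T [S [TS ST uT]]]; exists S, T; split=> //.
rewrite /intertwiner -[LHS]mulmx1 -[in LHS]scalar_entries1 -TS.
rewrite mul_scalar_entries [in LHS]mulmxA -[S%:KP *m _ *m _]mulmxA -uT.
by rewrite !mulmxA -mul_scalar_entries ST scalar_entries1 mul1mx.
Qed.

Lemma equivalent_trans u v w :
  equivalent u v -> equivalent v w -> equivalent u w.
Proof.
move=> [T [S [TS ST uT]]] [T' [S' [TS' ST' vT']]].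
exists (T' *m T), (S *m S'); split; last exact: intertwiner_comp uT vT'.
  by rewrite mulmxA -[T' *m _ *m _]mulmxA TS mulmx1.
by rewrite mulmxA -[S *m _ *m _]mulmxA ST' mulmx1.
Qed.

Lemma equivalent_rdim u v : equivalent u v -> rdim u = rdim v.
Proof.
move=> [T [S [TS ST _]]]; apply/eqP; rewrite eqn_leq.
have le p q (A : 'M[C]_(p, q)) (B : 'M[C]_(q, p)) : A *m B = 1%:M -> (p <= q)%N.
  move=> AB; rewrite -(mxrank1 C p) -AB.
  exact: leq_trans (mxrankM_maxl _ _) (rank_leq_col _).
by rewrite (le _ _ _ _ TS) (le _ _ _ _ ST).
Qed.

(** With $A=vT$ one has $u=SA$ and $v=AS$. The entries of $S$ are scalars, so both products have the
    same trace. *)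
Lemma equivalent_character u v : equivalent u v -> character u = character v.
Proof.
move=> [T [S [TS ST uT]]]; rewrite /character.
pose A := rmx v *m T%:KP.
have -> : rmx u = S%:KP *m A.
  by rewrite /A -uT mulmxA -mul_scalar_entries ST scalar_entries1 mul1mx.
have -> : rmx v = A *m S%:KP.
  by rewrite -mulmxA -mul_scalar_entries TS scalar_entries1 mulmx1.
rewrite /mxtrace; under eq_bigr do rewrite mulE_l.
by rewrite exchange_big; apply: eq_bigr => i _; rewrite mulE_r.
Qed.

Lemma intertwiner_conj u v (T : 'M[C]_(rdim v, rdim u)) :
  intertwiner T ->
  intertwiner (u := conj_rep u) (v := conj_rep v) (map_mx Num.conj T).
Proof.
move=> /intertwinerP uT; apply/intertwinerP => i j.
transitivity (\sum_k KPstar (T i k *: rmx u k j)).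
  by apply: eq_bigr => k _; rewrite KPstarZ conj_repE [map_mx _ _ _ _]mxE.
rewrite -KPstar_sum uT KPstar_sum; apply: eq_bigr => k _.
by rewrite KPstarZ conj_repE [map_mx _ _ _ _]mxE.
Qed.

Lemma equivalent_conj u v :
  equivalent u v -> equivalent (conj_rep u) (conj_rep v).
Proof.
move=> [T [S [TS ST uT]]].
have mapM p q r (A : 'M[C]_(p, q)) (B : 'M[C]_(q, r)) :
  map_mx Num.conj A *m map_mx Num.conj B = map_mx Num.conj (A *m B).
  by rewrite map_mxM.
exists (map_mx Num.conj T), (map_mx Num.conj S); split.
- by rewrite mapM TS map_mx1.
- by rewrite mapM ST map_mx1.
- exact: intertwiner_conj.
Qed.

Lemma irreducible_conj u : irreducible u -> irreducible (conj_rep u).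
Proof.
move=> [u_gt0 irr_u]; split=> [|T uT]; first exact: u_gt0.
have : is_scalar_mx (map_mx Num.conj T).
  by apply: irr_u; have := intertwiner_conj uT; rewrite /intertwiner conj_repK.
move=> /is_scalar_mxP[l Tl]; apply/is_scalar_mxP; exists (Num.conj l).
apply/matrixP => i j; have /matrixP/(_ i j) := Tl; rewrite !mxE.
by move=> /(congr1 Num.conj); rewrite conjCK => ->; rewrite rmorphMn.
Qed.

(** By irreducibility $T^*T$ and $TT^*$ are scalars $l$ and $m$. They agree because
    $T(T^*T)=(TT^*{})T$ and $T\ne0$, and $l\ne0$ for the same reason, so $l^{-1}T^*$ inverts $T$. *)
Lemma schur u v (T : 'M[C]_(rdim v, rdim u)) :
  irreducible u -> irreducible v -> intertwiner T -> T != 0 -> equivalent u v.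
Proof.
move=> [_ irr_u] [_ irr_v] uT T_neq0.
have Tu := intertwiner_ctr uT.
have /is_scalar_mxP[l TlT] := irr_u _ (intertwiner_comp uT Tu).
have /is_scalar_mxP[m TmT] := irr_v _ (intertwiner_comp Tu uT).
have l_neq0 : l != 0.
  apply: contra_neq T_neq0 => l0; apply: ctr_mul_eq0.
  by rewrite TlT l0 raddf0.
have lm : l = m.
  apply/eqP; rewrite -subr_eq0; have : (l - m) *: T = 0.
    rewrite scalerBl -[m *: T]mul_scalar_mx -[l *: T]mul_mx_scalar -TmT -TlT.
    by rewrite mulmxA subrr.
  by move=> /eqP; rewrite scaler_eq0 (negPf T_neq0) orbF.
exists T, (l^-1 *: ctr T); split=> //.
  by rewrite -scalemxAr TmT -lm scale_scalar_mx mulVf.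
by rewrite -scalemxAl TlT scale_scalar_mx mulVf.
Qed.

(** * Averaging with the Haar state and orthogonality *)

Lemma comul_strong x y b :
  \sum_c comul x (b, c) * (haar_weight R c * KPcoord (base_star c) y) =
  \sum_a haar_weight R a * KPcoord a x *
    comul y (base_antipode b, base_star a).
Proof.
rewrite (reindex_inj (inv_inj (@base_starK n))) /=.
under eq_bigr do rewrite base_starK haar_weight_star comulE // mulr_suml.
under [RHS]eq_bigr do rewrite comulE // mulr_sumr.
rewrite exchange_big; apply: eq_bigr => a _; apply: eq_bigr => c _ /=.
transitivity (KPcoord a x * KPcoord c y *
    (comul_coef R a b (base_star c) * haar_weight R c)); first by ring.
by rewrite comul_coef_strong //; ring.
Qed.

Definition haar_mx u v (j : 'I_(rdim u)) (l : 'I_(rdim v)) :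
    'M[C]_(rdim u, rdim v) :=
  \matrix_(p, k) haar (rmx u p j * rmx v k l).

(** Take strong invariance with $x=u_{ij}$ and $y=v_{kl}$. Expanding both coproducts over matrix
    entries gives the two sides of the intertwining relation; the antipode in it turns $v$ into its
    conjugate. *)
Lemma haar_mx_intertwiner u v (j : 'I_(rdim u)) (l : 'I_(rdim v)) :
  intertwiner (u := conj_rep v) (v := u) (haar_mx j l).
Proof.
apply/matrixP => i k; apply: KPcoordE => b.
rewrite mulE_l mulE_r !KPcoord_sum.
transitivity (\sum_a haar_weight R a * KPcoord a (rmx u i j) *
    comul (rmx v k l) (base_antipode b, base_star a)).
  under [RHS]eq_bigr do rewrite rep_comul sum_ffunE mulr_sumr.
  rewrite exchange_big; apply: eq_bigr => q _.
  rewrite KPcoordZ !mxE -rep_antipode KPcoord_antipode haarM // mulr_suml.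
  by apply: eq_bigr => a _; rewrite tensE; ring.
rewrite -comul_strong.
under eq_bigr do rewrite rep_comul sum_ffunE mulr_suml.
rewrite exchange_big; apply: eq_bigr => q _.
rewrite KPcoordZ mxE haarM // mulr_suml.
by apply: eq_bigr => c _; rewrite tensE; ring.
Qed.

Lemma haar_orthogonal u v p j k l :
  irreducible u -> irreducible v -> ~ equivalent (conj_rep v) u ->
  haar (rmx u p j * rmx v k l) = 0.
Proof.
move=> irr_u irr_v not_vu.
have [/matrixP/(_ p k)|M_neq0] := eqVneq (haar_mx j l) 0.
  by rewrite !mxE.
case: not_vu; apply: (schur (irreducible_conj irr_v) irr_u _ M_neq0).
exact: haar_mx_intertwiner.
Qed.

(** By irreducibility the averaged matrix is a scalar $m$. Its trace $m\,d_u$ is, by traciality, the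
    Haar state of the entry $(l,j)$ of $u^*u=1$. *)
Lemma haar_conj_rep u p j k l : irreducible u ->
  haar (rmx u p j * rmx (conj_rep u) k l) =
  (p == k)%:R * (j == l)%:R / (rdim u)%:R.
Proof.
move=> [u_gt0 irr_u].
have : is_scalar_mx (haar_mx (v := conj_rep u) j l).
  (* The averaged matrix starts at the double conjugate of [u], whose matrix is that of [u]
     itself. *)
  apply: irr_u; have := haar_mx_intertwiner (v := conj_rep u) j l.
  by rewrite /intertwiner conj_repK.
move=> /is_scalar_mxP[m mE].
have hE p' k' : haar (rmx u p' j * rmx (conj_rep u) k' l) = m * (p' == k')%:R.
  by have /matrixP/(_ p' k') := mE; rewrite !mxE mulr_natr => ->.
have d_neq0 : (rdim u)%:R != 0 :> C by rewrite pnatr_eq0 -lt0n.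
rewrite hE mulrC -mulrA; congr (_ * _); apply: (mulIf d_neq0); rewrite divfK //.
have : \sum_p' haar (rmx u p' j * rmx (conj_rep u) p' l) = m * (rdim u)%:R.
  under eq_bigr do rewrite hE eqxx mulr1.
  by rewrite sumr_const card_ord mulr_natr.
move=> <-.
have : haar ((hadj (rmx u) *m rmx u) l j) = (j == l)%:R.
  rewrite rep_unitl mxE eq_sym; case: (j == l); first by rewrite haar1.
  by rewrite raddf0.
move=> <-; rewrite mxE raddf_sum; apply: eq_bigr => q _.
rewrite haarC; last exact: n_gt1.
by congr (haar (_ * _)); rewrite conj_repE [RHS]mxE.
Qed.

Lemma haar_character u p j : irreducible u ->
  haar (rmx u p j * character (conj_rep u)) = (p == j)%:R / (rdim u)%:R.
Proof.
move=> irr_u; rewrite /character /mxtrace mulr_sumr raddf_sum /=.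
under eq_bigr do rewrite (@haar_conj_rep u) //.
under eq_bigr do rewrite mulrAC.
by rewrite sum_eqr.
Qed.

(** * Convolution of functionals on representation coefficients *)

Lemma scalar_vec (phi : {scalar KP}) x :
  phi x = \sum_b KPcoord b x * phi (KPvec R b).
Proof.
rewrite {1}[x]KPvec_sum linear_sum; apply: eq_bigr => b _.
by rewrite linearZ.
Qed.

Lemma convol_rep (phi psi : {scalar KP}) u i j :
  convol phi psi (rmx u i j) = \sum_k phi (rmx u i k) * psi (rmx u k j).
Proof.
rewrite -[LHS]/(tensor_functional phi psi (comul (rmx u i j))).
rewrite /tensor_functional rep_comul.
under eq_bigr do rewrite sum_ffunE mulr_suml.
rewrite exchange_big; apply: eq_bigr => k _ /=.
rewrite (scalar_vec phi) (scalar_vec psi) mulr_suml.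
under [RHS]eq_bigr do rewrite mulr_sumr.
rewrite pair_big; apply: eq_bigr => -[b c] _ /=.
by rewrite tensE mulrACA.
Qed.

(** Convolution becomes the matrix product on $u$, where [phi] acts as the scalar [l]. The zeroth
    power is the counit, which gives the identity matrix. *)
Lemma convol_pow_rep (phi : {scalar KP}) u (l : C) k i j :
  (forall p q, phi (rmx u p q) = (p == q)%:R * l) ->
  convol_pow phi k (rmx u i j) = (i == j)%:R * l ^+ k.
Proof.
move=> phi_u; elim: k i j => [|k IHk] i j.
  by rewrite mulr1 -rep_counit.
rewrite -[LHS]/(convol phi (convol_pow phi k) _) convol_rep.
under eq_bigr do rewrite phi_u IHk.
rewrite -(sum_eqr i (fun s => (s == j)%:R * l ^+ k.+1)).
by apply: eq_bigr => s _; rewrite exprS; ring.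
Qed.

Lemma equivalent_conjK u : equivalent (conj_rep (conj_rep u)) u.
Proof.
exists 1%:M, 1%:M; split; [exact: mulmx1|exact: mulmx1|].
by rewrite /intertwiner conj_repK !scalar_entries1 mulmx1 mul1mx.
Qed.

(** By orthogonality only the class of the conjugate of [w beta] contributes, and its character may
    be computed on that conjugate. *)
Lemma fourier_irreducible (I : finType) (w : I -> representation R n)
    (a : I -> C) beta alpha i j :
  irreducible_classes w -> equivalent (conj_rep (w beta)) (w alpha) ->
  fourier (\sum_gamma a gamma *: character (w gamma)) (rmx (w beta) i j) =
  (i == j)%:R * (a alpha / (rdim (w alpha))%:R).
Proof.
move=> [irr_w inj_w _] ba.
rewrite -[LHS]/(haar (_ * _)) mulr_sumr raddf_sum /= (bigD1 alpha) //=.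
rewrite big1 ?addr0 => [|gamma ga].
  rewrite KPscaleAr linearZ /= -(equivalent_character ba) haar_character //.
  have -> : rdim (w alpha) = rdim (w beta) by rewrite -(equivalent_rdim ba).
  by rewrite mulrCA.
rewrite KPscaleAr linearZ /= /character /mxtrace mulr_sumr raddf_sum /=.
rewrite big1 ?mulr0 // => k _; apply: haar_orthogonal => // eq_gb.
(* Were the conjugate of [w gamma] equivalent to [w beta], a second conjugation would make [w gamma]
   equivalent to [w alpha]. *)
move/eqP: ga; case; apply: inj_w; apply: equivalent_trans ba.
apply: equivalent_trans (equivalent_conj eq_gb).
exact: equivalent_sym (equivalent_conjK _).
Qed.

End Representations.

(** * Two-dimensional representations *)

Section Irreducibles.
Variables (R : realType) (n : nat).
Hypothesis n_gt1 : (1 < n)%N.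
Local Notation C := (complex R).
Local Notation X := (@etaX R n).
Local Notation KP := (KP R n).
Implicit Types (a b c : KPbase n) (x y z : KP) (u v : 'Z_n).

(* chE u v and chM u v are the Fourier bases of the two summands; they are the
   diagonal and off-diagonal entries of the two-dimensional representations
   X^{u,v}, and the components of rho_l^± and sigma_l^± when v = - v. *)
Definition chE u v : KP := ([ffun p => X (p.1 * u + p.2 * v)], 0).

Definition chM u v : KP := (0, \matrix_(m, r) (X (m * v) * (r == m + u)%:R)).

Lemma chE_inl u v p : KPcoord (inl p) (chE u v) = X (p.1 * u + p.2 * v).
Proof. by rewrite /= ffunE. Qed.

Lemma chE_inr u v p : KPcoord (inr p) (chE u v) = 0.
Proof. by rewrite /= mxE. Qed.

Lemma chM_inl u v p : KPcoord (inl p) (chM u v) = 0.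
Proof. by rewrite /= ffunE. Qed.

Lemma chM_inr u v p :
  KPcoord (inr p) (chM u v) = X (p.1 * v) * (p.2 == p.1 + u)%:R.
Proof. by rewrite /= mxE. Qed.

Definition chE_chM := (chE_inl, chE_inr, chM_inl, chM_inr).

(** Together with [comul_chM], this is what makes [plane_mx] below comultiplicative. *)
Lemma comul_chE u v b c : comul (chE u v) (b, c) =
  KPcoord b (chE u v) * KPcoord c (chE u v) +
  KPcoord b (chM u (- v)) * KPcoord c (chM u v).
Proof.
have nC := natn_neq0 n_gt1 C.
rewrite comulE // big_KPbase.
rewrite [X in _ + X = _]big1 => [|p _]; last by rewrite chE_inr mul0r.
rewrite addr0; under eq_bigr do rewrite chE_inl.
case: b c => [q|[q1 q2]] [r|[r1 r2]];
  rewrite !chE_chM ?mulr0 ?mul0r ?addr0 ?add0r /=.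
- by rewrite sum_eqr -etaXD //; congr (X _); rewrite /=; ring.
- by rewrite big1 // => p _; rewrite mulr0.
- by rewrite big1 // => p _; rewrite mulr0.
rewrite sum_pair /=.
(* The sum over the first index is a character sum forcing $q_2=q_1+u$; the second index can only be
   $r_1-q_1$. *)
transitivity (n%:R^-1 * (\sum_i X (i * (u + q1 - q2))) *
  \sum_j (X (j * v) * (r2 == q2 + j)%:R) * (r1 - q1 == j)%:R).
  rewrite -mulrA mulr_suml mulr_sumr; apply: eq_bigr => i _.
  rewrite !mulr_sumr; apply: eq_bigr => j _.
  have -> : ((r1, r2) == diag_shift (q1, q2) j) =
      (r2 == q2 + j) && (r1 - q1 == j).
    by rewrite xpair_eqE /= andbC subr_eq [j + q1]addrC.
  rewrite -mulnb natrM etaXD //.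
  have -> : i * (u + q1 - q2) = i * u + i * (q1 - q2) by ring.
  by rewrite etaXD //; ring.
rewrite sum_eqr sum_etaX // mulKf //.
have -> : (u + q1 - q2 == 0) = (q2 == q1 + u) by rewrite subr_eq0 eq_sym addrC.
have [->|_] := eqVneq q2 (q1 + u); last by rewrite !(mulr0, mul0r).
have -> : q1 + u + (r1 - q1) = r1 + u by ring.
by rewrite mul1r mulr1 [RHS]mulrA -etaXD //; congr (X _ * _); ring.
Qed.

Lemma comul_chM u v b c : comul (chM u v) (b, c) =
  KPcoord b (chE u (- v)) * KPcoord c (chM u v) +
  KPcoord b (chM u v) * KPcoord c (chE u v).
Proof.
rewrite comulE // big_KPbase.
rewrite [X in X + _ = _]big1 => [|p _]; last by rewrite chM_inl mul0r.
rewrite add0r; under eq_bigr do rewrite chM_inr.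
case: b c => [q|[q1 q2]] [r|[r1 r2]];
  rewrite !chE_chM ?mulr0 ?mul0r ?addr0 ?add0r /=.
- by rewrite big1 // => p _; rewrite mulr0.
- transitivity (\sum_p (X (p.1 * v) * (p.2 == p.1 + u)%:R *
      X (q.1 * (p.2 - p.1))) * ((r1 - q.2, r2 - q.2) == p)%:R).
    apply: eq_bigr => -[p1 p2] _; rewrite !mulrA /=; congr (_ * _%:R).
    by rewrite !xpair_eqE /= !subr_eq.
  rewrite sum_eqr /=.
  have -> : (r2 - q.2 == r1 - q.2 + u) = (r2 == r1 + u).
    by rewrite subr_eq addrAC subrK.
  have [->|_] := eqVneq r2 (r1 + u); last by rewrite !(mulr0, mul0r).
  by rewrite !mulr1 -!etaXD //; congr (X _); ring.
- under eq_bigr do rewrite [_ == diag_shift _ _]eq_sym mulrA.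
  rewrite sum_eqr /=.
  have -> : (q2 + r.2 == q1 + r.2 + u) = (q2 == q1 + u).
    by rewrite addrAC (inj_eq (addIr _)).
  have [->|_] := eqVneq q2 (q1 + u); last by rewrite !(mulr0, mul0r).
  by rewrite !mulr1 -!etaXD //; congr (X _); ring.
- by rewrite big1 // => p _; rewrite mulr0.
Qed.

Lemma KPstar_chE u v : KPstar (chE u v) = chE (- u) (- v).
Proof.
apply: KPcoordE => -[p|p]; rewrite KPcoord_star !chE_chM ?rmorph0 //.
by rewrite conj_etaX //; congr (X _); ring.
Qed.

Lemma chE_mul u v u' v' : chE u v * chE u' v' = chE (u + u') (v + v').
Proof.
apply: KPcoordE => -[p|[i j]].
  by rewrite KPcoordM_inl !chE_chM -etaXD //; congr (X _); ring.
by rewrite KPcoordM_inr big1 ?chE_chM // => k _; rewrite chE_inr mul0r.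
Qed.

Lemma chE_chM_mul u v u' v' : chE u v * chM u' v' = 0.
Proof.
apply: KPcoordE => -[p|[i j]].
  by rewrite KPcoordM_inl chM_inl mulr0 [RHS]ffunE.
by rewrite KPcoordM_inr [RHS]mxE big1 // => k _; rewrite chE_inr mul0r.
Qed.

Lemma chM_chE_mul u v u' v' : chM u v * chE u' v' = 0.
Proof.
apply: KPcoordE => -[p|[i j]].
  by rewrite KPcoordM_inl chM_inl mul0r [RHS]ffunE.
by rewrite KPcoordM_inr [RHS]mxE big1 // => k _; rewrite chE_inr mulr0.
Qed.

Lemma star_chE_chM u v u' v' : KPstar (chE u v) * chM u' v' = 0.
Proof. by rewrite KPstar_chE chE_chM_mul. Qed.

Lemma star_chM_chE u v u' v' : KPstar (chM u v) * chE u' v' = 0.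
Proof.
by rewrite -[LHS](@KPstarK R n) KPstarM KPstarK star_chE_chM KPstar0.
Qed.

Lemma chM_star_chE u v u' v' : chM u v * KPstar (chE u' v') = 0.
Proof. by rewrite KPstar_chE chM_chE_mul. Qed.

Lemma chE_star_chM u v u' v' : chE u v * KPstar (chM u' v') = 0.
Proof.
by rewrite -[LHS](@KPstarK R n) KPstarM KPstarK chM_star_chE KPstar0.
Qed.

Lemma chE_star_chE u v : chE u v * KPstar (chE u v) = chE 0 0.
Proof. by rewrite KPstar_chE chE_mul !subrr. Qed.

Lemma star_chE_chE u v : KPstar (chE u v) * chE u v = chE 0 0.
Proof. by rewrite KPstar_chE chE_mul !addNr. Qed.

(** On the matrix summand [chM u v] is a permutation matrix with entries rescaled by roots of unity,
    hence unitary; [1 - chE 0 0] is the unit of that summand. *)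
Lemma star_chM_chM u v : KPstar (chM u v) * chM u v = 1 - chE 0 0.
Proof.
apply/eqP; rewrite -subr_eq opprK; apply/eqP.
apply: KPcoordE => -[p|[i j]]; rewrite KPcoordD.
  rewrite KPcoordM_inl chM_inl mulr0 add0r chE_inl KPcoord1_inl.
  by rewrite !mulr0 addr0 etaX0.
rewrite chE_inr addr0 KPcoordM_inr KPcoord1_inr.
transitivity (\sum_k (i - u == j - u)%:R * (i - u == k)%:R : C).
  apply: eq_bigr => k _; rewrite KPcoord_star !chM_inr /= rmorphM /=.
  rewrite conj_etaX // rmorph_nat -(subr_eq i k) -(subr_eq j k).
  have [<-|_] := eqVneq (i - u) k; last by rewrite !(mulr0,mul0r).
  by rewrite !mulr1 mulrA [X (- _) * _]mulrC etaXNr // mul1r eq_sym.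
by rewrite sum_eqr (inj_eq (addIr _)).
Qed.

Lemma chM_star_chM u v : chM u v * KPstar (chM u v) = 1 - chE 0 0.
Proof.
apply/eqP; rewrite -subr_eq opprK; apply/eqP.
apply: KPcoordE => -[p|[i j]]; rewrite KPcoordD.
  rewrite KPcoordM_inl chM_inl mul0r add0r chE_inl KPcoord1_inl.
  by rewrite !mulr0 addr0 etaX0.
rewrite chE_inr addr0 KPcoordM_inr KPcoord1_inr.
transitivity (\sum_k (i == j)%:R * (i + u == k)%:R : C).
  apply: eq_bigr => k _; rewrite KPcoord_star !chM_inr /=.
  rewrite [Num.conj _]rmorphM /=.
  rewrite conj_etaX // rmorph_nat !(eq_sym k).
  have [<-|_] := eqVneq (i + u) k; last by rewrite !(mulr0, mul0r).
  rewrite !mulr1 (inj_eq (addIr _)) eq_sym.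
  have [->|_] := eqVneq i j; first by rewrite !mulr1 etaXNr.
  by rewrite !mulr0.
by rewrite sum_eqr.
Qed.

Definition sgn_opp (i : 'I_2) v : 'Z_n := if i == 0 then v else - v.

(** Its trace is the character formula of $\mathfrak X^{u,v}$, here for an arbitrary residue [v].
    The sign in an off-diagonal entry is governed by the column. *)
Definition plane_mx u v : 'M[KP]_2 :=
  \matrix_(i, j) if i == j then chE u (sgn_opp i v) else chM u (sgn_opp j v).

Lemma plane_mxE u v :
  [/\ plane_mx u v 0 0 = chE u v, plane_mx u v 0 1 = chM u (- v),
      plane_mx u v 1 0 = chM u v & plane_mx u v 1 1 = chE u (- v)].
Proof. by split; rewrite mxE. Qed.

Lemma ord2P (P : 'I_2 -> Prop) : P 0 -> P 1 -> forall i, P i.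
Proof.
by move=> P0 P1 [[|[|//]] lti]; [have -> : Ordinal lti = 0 by apply: val_inj|
  have -> : Ordinal lti = 1 by apply: val_inj].
Qed.

Lemma sum_ord2 (V : nmodType) (F : 'I_2 -> V) : \sum_i F i = F 0 + F 1.
Proof.
rewrite big_ord_recl big_ord_recl big_ord0 addr0; congr (_ + F _).
exact: val_inj.
Qed.

Lemma plane_mx_comul u v i j :
  comul (plane_mx u v i j) = \sum_k tens (plane_mx u v i k) (plane_mx u v k j).
Proof.
apply/ffunP => -[b c]; rewrite [RHS]sum_ffunE [RHS]sum_ord2. rewrite !tensE.
have [p00 p01 p10 p11] := plane_mxE u v.
elim/ord2P: i; elim/ord2P: j; rewrite ?p00 ?p01 ?p10 ?p11.
- exact: comul_chE.
- by rewrite comul_chM opprK.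
- by rewrite comul_chM addrC.
- by rewrite comul_chE opprK addrC.
Qed.

(** Each entry is unitary within its own summand and the two summands annihilate each other, so the
    diagonal sums add the units [chE 0 0] and [1 - chE 0 0]. *)
Lemma plane_mx_unitary u v :
  adjoint (plane_mx u v) *m plane_mx u v = 1%:M /\
  plane_mx u v *m adjoint (plane_mx u v) = 1%:M.
Proof.
have [p00 p01 p10 p11] := plane_mxE u v.
have adjE i j : adjoint (plane_mx u v) i j = KPstar (plane_mx u v j i).
  exact: mxE.
split; apply/matrixP => i j; rewrite [LHS]mxE [RHS]mxE sum_ord2 !adjE.
  elim/ord2P: i; elim/ord2P: j; rewrite ?p00 ?p01 ?p10 ?p11 ?star_chE_chE
    ?star_chM_chM ?star_chE_chM ?star_chM_chE ?addr0 //.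
  - by rewrite addrC subrK.
  - by rewrite subrK.
elim/ord2P: i; elim/ord2P: j; rewrite ?p00 ?p01 ?p10 ?p11 ?chE_star_chE
  ?chM_star_chM ?chE_star_chM ?chM_star_chE ?addr0 //.
- by rewrite addrC subrK.
- by rewrite subrK.
Qed.

Definition plane_rep u v : representation R n :=
  Representation (@plane_mx_comul u v) (plane_mx_unitary u v).

(** At the coordinate $e_{(0,1)}$ the matrix is diagonal with distinct entries [X v] and [X (- v)],
    so a commuting $T$ is diagonal. The coordinate $E_{0,u}$, where [chM u v] is 1, then equates its
    two diagonal entries. *)
Lemma plane_rep_irreducible u v : v != - v -> irreducible (plane_rep u v).
Proof.
move=> v_neqN; split=> [//|T /intertwinerP TE].
have {}TE (i j : 'I_2) : \sum_(k : 'I_2) T i k *: plane_mx u v k j =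
    \sum_(k : 'I_2) T k j *: plane_mx u v i k := TE i j.
have [p00 p01 p10 p11] := plane_mxE u v.
(* Equality would give [X (v + v) = 1], hence [v = - v]. *)
have X_neq : X v != X (- v).
  apply: contra v_neqN => /eqP XvN; rewrite -addr_eq0 -(etaX_eq1 R n_gt1).
  by rewrite etaXD // {1}XvN mulrC etaXNr.
have lin2E d (k l : C) x y :
  KPcoord d (k *: x + l *: y) = k * KPcoord d x + l * KPcoord d y.
  by rewrite KPcoordD 2!KPcoordZ.
have T01 d : T 0 0 * KPcoord d (chM u (- v)) + T 0 1 * KPcoord d (chE u (- v)) =
    T 0 1 * KPcoord d (chE u v) + T 1 1 * KPcoord d (chM u (- v)).
  rewrite -lin2E -[RHS]lin2E -p01 -p11 -p00.
  rewrite -[X in KPcoord d X = _](sum_ord2 (fun k => T 0 k *: _ k 1)).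
  by rewrite TE sum_ord2.
have T10 d : T 1 0 * KPcoord d (chE u v) + T 1 1 * KPcoord d (chM u v) =
    T 0 0 * KPcoord d (chM u v) + T 1 0 * KPcoord d (chE u (- v)).
  rewrite -lin2E -[RHS]lin2E -p10 -p11 -p00.
  rewrite -[X in KPcoord d X = _](sum_ord2 (fun k => T 1 k *: _ k 0)).
  by rewrite TE sum_ord2.
have T01_0 : T 0 1 = 0.
  have := T01 (inl (0, 1)); rewrite chM_inl 2!chE_inl /=.
  rewrite !mulr0 !mul0r !addr0 !add0r !mul1r => /eqP.
  rewrite -subr_eq0 -mulrBr mulf_eq0 subr_eq0 eq_sym => /orP[/eqP <-//|].
  by rewrite eq_sym (negPf X_neq).
have T10_0 : T 1 0 = 0.
  have := T10 (inl (0, 1)); rewrite chM_inl 2!chE_inl /=.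
  rewrite !mulr0 !mul0r !addr0 !add0r !mul1r => /eqP.
  by rewrite -subr_eq0 -mulrBr mulf_eq0 subr_eq0 (negPf X_neq) orbF => /eqP.
have T00_11 : T 0 0 = T 1 1.
  have := T10 (inr (0, u)); rewrite chM_inr 2!chE_inr /=.
  by rewrite mul0r add0r eqxx etaX0 !mulr0 !mulr1 addr0 add0r.
apply/is_scalar_mxP; exists (T 0 0); apply/matrixP => i j; rewrite [RHS]mxE.
by elim/ord2P: i; elim/ord2P: j; rewrite ?T01_0 ?T10_0 -?T00_11.
Qed.
End Irreducibles.

(** * Coefficients of irreducible representations span *)

Section PeterWeyl.
Variables (R : realType) (n : nat).
Hypothesis n_gt1 : (1 < n)%N.
Local Notation C := (complex R).
Local Notation X := (@etaX R n).
Local Notation KP := (KP R n).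
Implicit Types (a b c : KPbase n) (x y z t : KP) (u v : 'Z_n).

(** * One-dimensional representations *)

Lemma comul_lin x y (l : C) b c :
  comul (x + l *: y) (b, c) = comul x (b, c) + l * comul y (b, c).
Proof.
have : forall a, KPcoord a (x + l *: y) = KPcoord a x + l * KPcoord a y.
  by move=> a; rewrite KPcoordD KPcoordZ.
move: (x + l *: y) => z zE.
apply: etrans (comulE z b c) (esym _).
apply: (etrans (congr2 (fun p q => p + l * q) (comulE x b c) (comulE y b c))).
rewrite mulr_sumr -big_split.
by apply: eq_bigr => a _; rewrite zE mulrDl mulrA.
Qed.

Lemma signed_mul (e : C) x y z t : e * e = 1 ->
  x * z + y * t = 1 -> x * t = 0 -> y * z = 0 ->
  (x + e *: y) * (z + e *: t) = 1.
Proof.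
move=> ee xzyt xt yz; rewrite mulrDl !mulrDr !KPscaleAl !KPscaleAr.
by rewrite xt yz !scaler0 addr0 add0r scalerA ee scale1r.
Qed.

(** For [v = - v] the matrix [plane_mx u v] has equal diagonal and equal off-diagonal entries, and
    splits into their sum and difference. These are $\rho_u^\pm$ for $v=0$ and $\sigma_u^\pm$ for
    $v=n/2$, $n$ even. *)
Definition line_coef (s : bool) u v : KP := chE R u v + (-1) ^+ s *: chM R u v.

Lemma KPstar_line_coef s u v :
  KPstar (line_coef s u v) =
  KPstar (chE R u v) + (-1) ^+ s *: KPstar (chM R u v).
Proof.
rewrite /line_coef; move: (chE R u v) (chM R u v) => x y.
have e_conj : Num.conj ((-1) ^+ s : C) = (-1) ^+ s.
  by rewrite rmorphXn rmorphN1.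
apply: KPcoordE => a; rewrite KPcoord_star 2!KPcoordD 2!KPcoordZ.
by rewrite rmorphD rmorphM 2!KPcoord_star /= e_conj.
Qed.

Lemma line_coef_comul s u v : v = - v ->
  comul (line_coef s u v) = tens (line_coef s u v) (line_coef s u v).
Proof.
move=> vN; apply/ffunP => -[b c]; rewrite [RHS]tensE.
apply: (etrans (comul_lin _ _ _ b c)).
apply: (etrans (congr2 (fun p q => p + (-1) ^+ s * q)
  (comul_chE R n_gt1 u v b c) (comul_chM R n_gt1 u v b c))).
rewrite -vN /line_coef; move: (chE R u v) (chM R u v) => x y.
have ee : (-1) ^+ s * (-1) ^+ s = 1 :> C by rewrite -expr2 sqrr_sign.
move: ((-1) ^+ s) ee => e ee; rewrite 2!KPcoordD 2!KPcoordZ.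
(* The product of the two matrix parts has coefficient $1$ in the coproduct and $e^2$ in the tensor
   square. *)
by rewrite -[KPcoord b y * _]mul1r -ee; ring.
Qed.

Definition line_mx s u v : 'M[KP]_1 := \matrix_(i, j) line_coef s u v.

Lemma line_mx_comul s u v (vN : v = - v) (i j : 'I_1) :
  comul (line_mx s u v i j) =
  \sum_k tens (line_mx s u v i k) (line_mx s u v k j).
Proof.
rewrite big_ord1.
have lE p q : line_mx s u v p q = line_coef s u v by exact: mxE.
by rewrite !lE line_coef_comul.
Qed.

Lemma line_mx_unitary s u v :
  adjoint (line_mx s u v) *m line_mx s u v = 1%:M /\
  line_mx s u v *m adjoint (line_mx s u v) = 1%:M.
Proof.
have ee : (-1) ^+ s * (-1) ^+ s = 1 :> C by rewrite -expr2 sqrr_sign.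
have lE p q : line_mx s u v p q = line_coef s u v by exact: mxE.
have aE p q : adjoint (line_mx s u v) p q = KPstar (line_coef s u v).
  by rewrite -(lE p q) mxE !lE.
split; apply/matrixP => i j; rewrite [LHS]mxE [RHS]mxE big_ord1 lE aE;
  rewrite KPstar_line_coef !ord1 eqxx; apply: signed_mul ee _ _ _.
- by rewrite star_chE_chE // star_chM_chM // addrC subrK.
- exact: star_chE_chM.
- exact: star_chM_chE.
- by rewrite chE_star_chE // chM_star_chM // addrC subrK.
- exact: chE_star_chM.
- exact: chM_star_chE.
Qed.

Definition line_rep s u v (vN : v = - v) : representation R n :=
  Representation (line_mx_comul s u vN) (line_mx_unitary s u v).

Lemma line_rep_irreducible s u v (vN : v = - v) :
  irreducible (line_rep s u vN).
Proof.
split=> [//|T _]; apply/is_scalar_mxP; exists (T 0 0).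
exact: mx11_scalar.
Qed.

(** * Spanning, phrased as an induction principle for predicates stable under linear combinations *)

Variable P : KP -> Prop.
Hypothesis P_0 : P 0.
Hypothesis P_D : forall x y, P x -> P y -> P (x + y).
Hypothesis P_Z : forall (l : C) x, P x -> P (l *: x).
Hypothesis P_rep : forall w : representation R n, irreducible w ->
  forall i j, P (rmx w i j).

Lemma closed_sum (I : finType) (l : I -> C) (F : I -> KP) :
  (forall i, P (F i)) -> P (\sum_i l i *: F i).
Proof. by move=> PF; apply: (big_ind P) => // i _; apply: P_Z. Qed.

(** If [v] differs from [- v], both are entries of an irreducible [plane_rep]; otherwise they are
    the half sum and half difference of two one-dimensional representations. *)
Lemma closed_chE_chM u v : P (chE R u v) /\ P (chM R u v).
Proof.
have [vN|vN] := eqVneq v (- v); last first.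
  have irr := plane_rep_irreducible R n_gt1 u vN.
  have [p00 p01 p10 p11] := plane_mxE R u v.
  by rewrite -p00 -p10; split; [exact: (P_rep irr 0 0)|exact: (P_rep irr 1 0)].
have PL s : P (line_coef s u v).
  have := P_rep (line_rep_irreducible s u vN) 0 0.
  by rewrite [X in P X]mxE.
have half : 2^-1 + 2^-1 = 1 :> C by field.
have -> : chE R u v = 2^-1 *: line_coef false u v + 2^-1 *: line_coef true u v.
  rewrite /line_coef; move: (chE R u v) (chM R u v) => x y.
  rewrite expr0 expr1 scale1r scaleN1r 2!scalerDr addrACA.
  rewrite -scalerDl half scale1r.
  by rewrite scalerN subrr addr0.
have -> : chM R u v =
    2^-1 *: line_coef false u v + - 2^-1 *: line_coef true u v.
  rewrite /line_coef; move: (chE R u v) (chM R u v) => x y.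
  rewrite expr0 expr1 scale1r scaleN1r 2!scalerDr addrACA.
  rewrite -scalerDl subrr scale0r.
  by rewrite scalerN scaleNr opprK -scalerDl half scale1r add0r.
by split; apply: P_D; apply: P_Z.
Qed.

(** Fourier inversion on $\mathbb Z_n$: in both variables for $e_{(s,t)}$, and in [v] alone for
    $E_{m,r}$, whose position fixes the shift $u=r-m$. *)
Lemma closed_vec b : P (KPvec R b).
Proof.
have nC := natn_neq0 n_gt1 C.
case: b => [[s t]|[m r]].
  have -> : KPvec R (inl (s, t)) = \sum_(p : 'Z_n * 'Z_n)
      (n%:R^-1 * X (- (p.1 * s)) * (n%:R^-1 * X (- (p.2 * t)))) *:
      chE R p.1 p.2.
    apply: KPcoordE => -[[i j]|p]; rewrite KPcoord_vec KPcoord_sum; last first.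
      by rewrite big1 // => q _; rewrite KPcoordZ chE_inr mulr0.
    transitivity ((n%:R^-1 * \sum_u X (u * (i - s))) *
      (n%:R^-1 * \sum_v X (v * (j - t)))).
      rewrite !sum_etaX // [n%:R^-1 * _]mulKf // [n%:R^-1 * _]mulKf //.
      rewrite !subr_eq0 -natrM mulnb.
      by congr (_%:R); rewrite -xpair_eqE.
    rewrite sum_pair [n%:R^-1 * \sum_(_ < _) X (_ * (i - s))]mulr_sumr.
    rewrite mulr_suml; apply: eq_bigr => u _; rewrite !mulr_sumr.
    apply: eq_bigr => v _; rewrite KPcoordZ chE_inl /=.
    have -> : u * (i - s) = i * u - u * s by ring.
    have -> : v * (j - t) = j * v - v * t by ring.
    by rewrite !etaXD //; ring.
  by apply: closed_sum => p; have [] := closed_chE_chM p.1 p.2.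
have -> : KPvec R (inr (m, r)) = \sum_v
    (n%:R^-1 * X (- (v * m))) *: chM R (r - m) v.
  apply: KPcoordE => -[p|[i j]]; rewrite KPcoord_vec KPcoord_sum.
    by rewrite big1 // => q _; rewrite KPcoordZ chM_inl mulr0.
  transitivity ((n%:R^-1 * \sum_v X (v * (i - m))) * (j == i + (r - m))%:R).
    rewrite !sum_etaX // mulKf // subr_eq0 -natrM mulnb; congr (_%:R).
    rewrite -[_ == _]/((i, j) == (m, r)) xpair_eqE; congr nat_of_bool.
    by have [->|//] := eqVneq i m; rewrite addrC subrK.
  rewrite mulr_sumr mulr_suml; apply: eq_bigr => v _.
  rewrite KPcoordZ chM_inr /=.
  have -> : v * (i - m) = i * v - v * m by ring.
  by rewrite etaXD //; ring.
by apply: closed_sum => v; have [] := closed_chE_chM (r - m) v.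
Qed.

Lemma closed_all x : P x.
Proof. by rewrite [x]KPvec_sum; apply: closed_sum => b; exact: closed_vec. Qed.
End PeterWeyl.

(** * Convergence *)

Section Limits.
Variable R : realType.
Local Notation C := (complex R).

(** The condition [0 < e] in the order of the complex numbers forces [e] to be a positive real, so
    this is the usual criterion. *)
Lemma cvg_complexP (f : nat -> C) (l : C) :
  (f @ \oo --> (l : C^o))%classic <->
  (forall e : C, 0 < e -> exists N, forall k, (N <= k)%N -> `|l - f k| < e).
Proof.
have fl := @cvgrPdist_lt C C^o nat \oo%classic _ f l.
split=> [/fl{}fl e /fl[N _ fN]|fN]; first by exists N => k; apply: fN.
by apply/fl => e /fN[N {}fN]; exists N => // k; apply: fN.
Qed.

Lemma cvg_complexD (f g : nat -> C) (l m : C) :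
  (f @ \oo --> (l : C^o))%classic -> (g @ \oo --> (m : C^o))%classic ->
  ((fun k => f k + g k) @ \oo --> (l + m : C^o))%classic.
Proof. exact: (@cvgD C C^o). Qed.

Lemma cvg_complexM (f : nat -> C) (c l : C) :
  (f @ \oo --> (l : C^o))%classic ->
  ((fun k => c * f k) @ \oo --> (c * l : C^o))%classic.
Proof. by move=> fl; apply: (@cvgM C) fl; exact: cvg_cst. Qed.

(** Moduli and tolerances are embedded reals, so the claim reduces to the real geometric sequence of
    ratio $|c|$. *)
Lemma cvg_complexX (c : C) : `|c| < 1 ->
  ((fun k => c ^+ k) @ \oo --> (0 : C^o))%classic.
Proof.
move=> c_lt1; apply/cvg_complexP => e e_gt0.
have realE (x : C) : 0 <= x -> x = (complex.Re x)%:C%C.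
  by move=> x_ge0; rewrite RRe_real // ger0_real.
have eE := realE _ (ltW e_gt0); have cE := realE _ (normr_ge0 c).
have re_gt0 : 0 < complex.Re e by rewrite -ltcR -eE.
have rc_ge0 : 0 <= complex.Re `|c| by rewrite -ler0c -cE normr_ge0.
have rc_lt1 : `|complex.Re `|c| | < 1 by rewrite ger0_norm // -ltcR -cE.
have /cvgrPdist_lt/(_ _ re_gt0)[N _ fN] := cvg_expr rc_lt1.
exists N => k /fN /=; rewrite !sub0r !normrN normrX ger0_norm // => lt_k.
by rewrite normrX eE cE -rmorphXn ltcR.
Qed.

(** If $|c|\ge1$ and $c\ne1$, consecutive powers stay at distance $|c|^N|c-1|\ge|c-1|$, while two
    terms within $|c-1|/2$ of the limit are closer than that. *)
Lemma cvg_complexX_lt1_or1 (c l : C) :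
  ((fun k => c ^+ k) @ \oo --> (l : C^o))%classic -> `|c| < 1 \/ c = 1.
Proof.
move=> /cvg_complexP cl; have [|c_ge1] := boolP (`|c| < 1); first by left.
right; apply/eqP/negPn/negP; rewrite -subr_eq0 -normr_gt0 => e_gt0.
have /cl[N clN] : 0 < `|c - 1| / 2 by rewrite divr_gt0.
have : `|c ^+ N * (c - 1)| < `|c - 1|.
  rewrite mulrBr mulr1 -exprSr -(subrKA l) [ltRHS]splitr.
  apply: le_lt_trans (ler_normD _ _) _; rewrite distrC.
  by apply: ltrD; apply: clN.
rewrite normrM normrX gtr_pMl // => cN_lt1.
(* The order on the complex numbers is partial; the negation can be reversed because both sides are
   real. *)
rewrite -real_leNgt ?normr_real ?real1 // in c_ge1.
by have := lt_le_trans cN_lt1 (exprn_ege1 N c_ge1); rewrite ltxx.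
Qed.
End Limits.

(** * Pointwise limits of linear functionals *)

Section Functional.
Variables (R : realType) (n : nat).
Local Notation C := (complex R).
Local Notation KP := (KP R n).

Definition coord_functional_fun (L : KPbase n -> C) (x : KP) : C :=
  \sum_b KPcoord b x * L b.

Lemma coord_functional_fun_is_linear L :
  linear_for *%R (coord_functional_fun L).
Proof.
move=> c x y; rewrite /coord_functional_fun mulr_sumr -big_split.
by apply: eq_bigr => b _; rewrite KPcoordD KPcoordZ mulrDl mulrA.
Qed.

HB.instance Definition _ L := GRing.isLinear.Build C KP C *%R
  (coord_functional_fun L) (coord_functional_fun_is_linear L).

Definition coord_functional L : {scalar KP} := coord_functional_fun L.

Lemma coord_functional_vec L b : coord_functional L (KPvec R b) = L b.
Proof.
rewrite -[LHS]/(\sum_c _ * _) -[RHS](sum_eqr b).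
by apply: eq_bigr => c _; rewrite KPcoord_vec mulrC eq_sym.
Qed.

(** The limits on the standard basis define a linear functional, and linearity carries the
    convergence to every vector. *)
Lemma dual_cvgP (phi : nat -> {scalar KP}) :
  (forall y, exists l : C, ((fun k => phi k y) @ \oo --> (l : C^o))%classic) ->
  dual_cvg phi.
Proof.
move=> cvg_phi.
have /choice[L phiL] : forall b, exists l : C,
    ((fun k => phi k (KPvec R b)) @ \oo --> (l : C^o))%classic by [].
exists (coord_functional L) => y.
pose Q x :=
  ((fun k => phi k x) @ \oo --> (coord_functional L x : C^o))%classic.
have QD x z : Q x -> Q z -> Q (x + z).
  move=> Qx Qz; rewrite /Q (linearD (coord_functional L)).
  have -> : (fun k => phi k (x + z)) = (fun k => phi k x + phi k z).
    by apply/funext => k; exact: (linearD (phi k)).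
  exact: cvg_complexD Qx Qz.
have QZ (l : C) x : Q x -> Q (l *: x).
  move=> Qx; rewrite /Q (linearZ_LR (coord_functional L)).
  have -> : (fun k => phi k (l *: x)) = (fun k => l * phi k x).
    by apply/funext => k; exact: (linearZ_LR (phi k)).
  exact: cvg_complexM Qx.
have Q0 : Q 0.
  rewrite /Q (linear0 (coord_functional L)).
  have -> : (fun k => phi k 0) = (fun=> 0).
    by apply/funext => k; exact: (linear0 (phi k)).
  by apply/cvg_complexP => e e_gt0; exists 0%N => k _; rewrite subrr normr0.
have Qvec b : Q (KPvec R b) by rewrite /Q coord_functional_vec; exact: phiL.
have := closed_sum Q0 QD QZ (fun b => KPcoord b y) Qvec.
by rewrite -KPvec_sum; exact.
Qed.
End Functional.

(** * The random walk on coefficients of irreducible representations *)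

Section RandomWalk.
Variables (R : realType) (n : nat).
Hypothesis n_gt1 : (1 < n)%N.
Local Notation C := (complex R).
Local Notation KP := (KP R n).
Variables (I : finType) (w : I -> representation R n).
Hypothesis w_classes : irreducible_classes w.
Variable a : I -> C.
Local Notation walk :=
  (convol_pow (fourier (\sum_alpha a alpha *: character (w alpha)))).
Local Notation ratio alpha := (a alpha / (rdim (w alpha))%:R).

Lemma conj_class u : irreducible u ->
  exists beta, equivalent (conj_rep n_gt1 u) (w beta).
Proof.
by move=> irr_u; have [_ _ w_all] := w_classes; apply/w_all/irreducible_conj.
Qed.

Lemma walk_rep alpha beta k i j :
  equivalent (conj_rep n_gt1 (w beta)) (w alpha) ->
  walk k (rmx (w beta) i j) = (i == j)%:R * ratio alpha ^+ k.
Proof.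
move=> ba; apply: convol_pow_rep => p q.
exact: fourier_irreducible w_classes ba.
Qed.

(** Every class is that of a conjugate, so some diagonal coefficient of an irreducible
    representation evolves exactly as the powers of the given ratio. *)
Lemma walk_cvg_ratio alpha :
  dual_cvg walk -> `|ratio alpha| < 1 \/ ratio alpha = 1.
Proof.
move=> [l walk_l]; have [irr_w _ _] := w_classes.
have [beta ab] := conj_class (irr_w alpha).
(* Conjugation is an involution on classes, so [beta] and [alpha] can be exchanged. *)
have ba : equivalent (conj_rep n_gt1 (w beta)) (w alpha).
  apply: equivalent_trans (equivalent_conjK n_gt1 (w alpha)).
  exact: equivalent_conj (equivalent_sym ab).
have [beta_gt0 _] := irr_w beta; pose i := Ordinal beta_gt0.
apply: (@cvg_complexX_lt1_or1 _ _ (l (rmx (w beta) i i))).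
have -> : (fun k => ratio alpha ^+ k) = (fun k => walk k (rmx (w beta) i i)).
  by apply/funext => k; rewrite (walk_rep k i i ba) eqxx mul1r.
exact: walk_l.
Qed.

(** The vectors on which the walk converges form a subspace containing all coefficients of
    irreducible representations, hence everything. *)
Lemma walk_cvg : (forall alpha, `|ratio alpha| < 1 \/ ratio alpha = 1) ->
  dual_cvg walk.
Proof.
move=> ratioP; apply: dual_cvgP.
pose P y := exists l : C, ((fun k => walk k y) @ \oo --> (l : C^o))%classic.
have P0 : P 0.
  exists 0; apply/cvg_complexP => e e_gt0; exists 0%N => k _.
  by rewrite (linear0 (walk k)) subrr normr0.
have PD x y : P x -> P y -> P (x + y).
  move=> [l xl] [m ym]; exists (l + m).
  have -> : (fun k => walk k (x + y)) = (fun k => walk k x + walk k y).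
    by apply/funext => k; exact: (linearD (walk k)).
  exact: cvg_complexD xl ym.
have PZ (c : C) x : P x -> P (c *: x).
  move=> [l xl]; exists (c * l).
  have -> : (fun k => walk k (c *: x)) = (fun k => c * walk k x).
    by apply/funext => k; exact: (linearZ_LR (walk k)).
  exact: cvg_complexM xl.
have [irr_w _ w_all] := w_classes.
have Pw beta i j : P (rmx (w beta) i j).
  have [alpha ba] := conj_class (irr_w beta).
  have [l al] : exists l : C,
      ((fun k => ratio alpha ^+ k) @ \oo --> (l : C^o))%classic.
    have [lt1|->] := ratioP alpha; first by exists 0; exact: cvg_complexX.
    exists 1; apply/cvg_complexP => e e_gt0; exists 0%N => k _.
    by rewrite expr1n subrr normr0.
  exists ((i == j)%:R * l).
  have -> : (fun k => walk k (rmx (w beta) i j)) =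
      (fun k => (i == j)%:R * ratio alpha ^+ k).
    by apply/funext => k; exact: walk_rep.
  exact: cvg_complexM al.
apply: (closed_all n_gt1 P0 PD PZ) => u irr_u i j.
have [beta [T [S [TS ST uT]]]] := w_all u irr_u.
(* Through the equivalence, coefficients of [u] are linear combinations of those of its
   representative. *)
have -> : rmx u = scalar_entries n S *m (rmx (w beta) *m scalar_entries n T).
  by rewrite -uT mulmxA -mul_scalar_entries ST scalar_entries1 mul1mx.
rewrite mulE_l; apply: closed_sum => // k; rewrite mulE_r.
exact: closed_sum.
Qed.
End RandomWalk.

Theorem theorem3p1 (R : realType) (n : nat) (hn : (2 <= n)%N)
    (I : finType) (w : I -> representation R n)
    (hw : irreducible_classes w) (a : I -> complex R) :
  dual_cvg (convol_pow (fourier (\sum_alpha a alpha *: character (w alpha)))) <->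
  (forall alpha : I,
     `|a alpha / (rdim (w alpha))%:R| < 1 \/ a alpha / (rdim (w alpha))%:R = 1).
Proof.
split=> [walk_l alpha|]; first exact: walk_cvg_ratio walk_l.
exact: walk_cvg.
Qed.
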